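(* Let $q = 2^h$ with $h > 1$, let $n$ be a prime, and let $\mathcal{O} = \{\pi_0, \pi_1, \dots, \pi_{q^n}\}$ be a pseudo-oval of $\mathbf{PG}(3n-1, q)$ with tangent spaces $\tau_0, \dots, \tau_{q^n}$. For each $i \in \{0,\dots,q^n\}$ let $\mathbf{PG}(2n-1,q)$ be a $(2n-1)$-dimensional subspace skew to $\pi_i$, and let $\Delta_i = \{\eta_0, \dots, \eta_{q^n}\}$ where $\eta_i = \tau_i \cap \mathbf{PG}(2n-1,q)$ and $\eta_j = \langle \pi_i, \pi_j\rangle \cap \mathbf{PG}(2n-1,q)$ for $j \neq i$. Then $\mathcal{O}$ is regular if and only if all the $(n-1)$-spreads $\Delta_0, \Delta_1, \dots, \Delta_{q^n}$ are regular.
   Context: A generalized $k$-arc of $\mathbf{PG}(3n-1,q)$ is a set of $k$ subspaces of dimension $n-1$ any three of which span $\mathbf{PG}(3n-1,q)$. A pseudo-oval is a generalized $(q^n+1)$-arc. For each element $\pi_i$ of a pseudo-oval there is exactly one $(2n-1)$-dimensional subspace $\tau_i \supseteq \pi_i$ (the tangent space at $\pi_i$) containing no point of the other elements; $\Delta_i$ is then an $(n-1)$-spread of $\mathbf{PG}(2n-1,q)$, whose regularity does not depend on the chosen complement. An $(n-1)$-regulus of $\mathbf{PG}(2n-1,q)$ is a set of $q+1$ pairwise disjoint $(n-1)$-dimensional subspaces such that every line meeting three of them meets all of them, and every point of such a transversal lies in one of them (equivalently, one system of maximal subspaces of a Segre variety $\mathcal{S}_{1;n-1}$); any three pairwise disjoint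 $(n-1)$-spaces lie in a unique $(n-1)$-regulus. An $(n-1)$-spread is regular if for any three of its elements the $(n-1)$-regulus they determine is contained in the spread. Regular pseudo-oval: in the extension $\mathbf{PG}(3n-1,q^n)$ take planes $\xi_1,\dots,\xi_n$ forming an orbit of $\mathrm{Gal}(\mathbb{F}_{q^n}/\mathbb{F}_q)$ and spanning $\mathbf{PG}(3n-1,q^n)$; take an oval $\{x_0^{(1)},\dots,x_{q^n}^{(1)}\}$ of $\xi_1$ (a set of $q^n+1$ points no three collinear), let $x_i^{(1)},\dots,x_i^{(n)}$ be the Galois conjugates of $x_i^{(1)}$, and let $\pi_i$ be the $(n-1)$-dimensional subspace over $\mathbb{F}_q$ they span. The resulting $\{\pi_0,\dots,\pi_{q^n}\}$ is a pseudo-oval of $\mathbf{PG}(3n-1,q)$; pseudo-ovals arising this way (up to projective equivalence) are called regular. *)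

(* Defs.v *)
From HB Require Import structures.
From mathcomp Require Import all_boot all_order all_fingroup all_algebra.
From mathcomp Require Import all_solvable all_field.

Set Implicit Arguments.
Unset Strict Implicit.
Unset Printing Implicit Defensive.

Import GRing.Theory.
Local Open Scope ring_scope.

(* A d-dimensional subspace of PG(m - 1, q) is a (d + 1)-dimensional vector   *)
(* subspace of 'rV[F]_m with q = #|F|; disjoint (skew) projective subspaces   *)
(* are vector subspaces whose intersection is 0.                              *)

Section ReguliSpreads.

Variables (F : finFieldType) (V : vectType F) (n : nat).
Implicit Types (W A B C D l : {vspace V}) (R S : seq {vspace V}).

Definition meets A B : Prop := (A :&: B)%VS != 0%VS.

Definition disjoint_spaces A B : Prop := (A :&: B)%VS = 0%VS.

(* W plays the role of the ambient PG(2n-1,q). *)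
Definition regulus W R : Prop :=
  [/\ uniq R /\ size R = #|F|.+1,
      forall A, A \in R -> (A <= W)%VS /\ \dim A = n,
      forall A B, A \in R -> B \in R -> A != B -> disjoint_spaces A B
    & forall l A B C, (l <= W)%VS -> \dim l = 2%N ->
        A \in R -> B \in R -> C \in R -> uniq [:: A; B; C] ->
        meets l A -> meets l B -> meets l C ->
        (forall D, D \in R -> meets l D) /\
        (forall v, v \in l -> exists2 D, D \in R & v \in D)].

Definition spread W S : Prop :=
  [/\ forall A, A \in S -> (A <= W)%VS /\ \dim A = n,
      forall A B, A \in S -> B \in S -> A != B -> disjoint_spaces A B
    & forall v, v \in W -> exists2 A, A \in S & v \in A].

(* Three pairwise disjoint (n-1)-spaces of PG(2n-1,q) lie in a unique         *)
(* (n-1)-regulus, so R below is the regulus determined by A, B and C.         *)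
Definition regular_spread W S : Prop :=
  spread W S /\
  forall A B C, A \in S -> B \in S -> C \in S -> uniq [:: A; B; C] ->
    exists R, [/\ regulus W R, {subset [:: A; B; C] <= R} & {subset R <= S}].

End ReguliSpreads.

Section PseudoOvals.

Variables (F : finFieldType) (n : nat).
Local Notation V := 'rV[F]_(3 * n).

Definition generalized_arc (k : nat) (pi : 'I_k -> {vspace V}) : Prop :=
  [/\ injective pi,
      forall i, \dim (pi i) = n
    & forall i j l, uniq [:: i; j; l] -> (pi i + pi j + pi l)%VS = fullv].

Definition pseudo_oval (pi : 'I_(#|F| ^ n).+1 -> {vspace V}) : Prop :=
  generalized_arc pi.

Definition tangent_space (k : nat) (pi : 'I_k -> {vspace V}) (i : 'I_k)
    (T : {vspace V}) : Prop :=
  [/\ (pi i <= T)%VS, \dim T = (2 * n)%N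
    & forall j, j != i -> disjoint_spaces T (pi j)].

Definition Delta (k : nat) (pi tau : 'I_k -> {vspace V}) (i : 'I_k)
    (W : {vspace V}) : seq {vspace V} :=
  [seq (if j == i then tau i :&: W else (pi i + pi j) :&: W)%VS | j : 'I_k].

(* L plays the role of F_(q^n). *)
Variable L : splittingFieldType F.
Local Notation VL := 'rV[L]_(3 * n).

(* The coordinatewise image of U by s; as s is bijective and semilinear, this *)
(* does not depend on the basis, see mem_conj_space.                          *)
Definition conj_space (s : gal_of {:L}) (U : {vspace VL}) : {vspace VL} :=
  <<[seq map_mx s v | v <- vbasis U]>>%VS.

Lemma mem_conj_space (s : gal_of {:L}) (U : {vspace VL}) (v : VL) :
  (map_mx s v \in conj_space s U) = (v \in U).
Proof.
apply/idP/idP => [|vU]; last first.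
  rewrite (coord_vbasis vU) raddf_sum memv_suml // => i _.
  rewrite /= map_mxZ memvZ // memv_span //.
  by apply/map_f/mem_nth; rewrite size_tuple.
have sK (w : VL) : map_mx (s^-1)%g (map_mx s w) = w.
  apply/matrixP => i j; rewrite !mxE.
  by rewrite -(galM _ _ (memvf _)) mulgV gal_id.
have -> : conj_space s U = <<map_tuple (map_mx s) (vbasis U)>>%VS by [].
move=> /coord_span e; rewrite -[v]sK e raddf_sum memv_suml // => i _.
rewrite /= map_mxZ memvZ // (nth_map 0) ?size_tuple // sK.
by apply/vbasis_mem/mem_nth; rewrite size_tuple.
Qed.

Definition conj_span (U : {vspace VL}) : {vspace VL} :=
  (\sum_(s in 'Gal({:L} / 1)%g) conj_space s U)%VS.

Definition oval (xi : {vspace VL})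
    (x : 'I_(#|F| ^ n).+1 -> {vspace VL}) : Prop :=
  [/\ injective x,
      forall i, (x i <= xi)%VS /\ \dim (x i) = 1%N
    & forall i j l, uniq [:: i; j; l] -> (2 < \dim (x i + x j + x l))%N].

(* When L has degree n over F, the group has order n, so the condition        *)
(* conj_span xi = fullv forces xi to have n distinct conjugates.              *)
(* The members of pi are the sets of F-rational points of the spans of the    *)
(* conjugates of the points of the oval.                                      *)
Definition oval_descent (pi : 'I_(#|F| ^ n).+1 -> {vspace V}) : Prop :=
  exists (xi : {vspace VL}) (x : 'I_(#|F| ^ n).+1 -> {vspace VL}),
    [/\ \dim xi = 3%N, conj_span xi = fullv, oval xi x
      & forall i v, (v \in pi i) = (map_mx (in_alg L) v \in conj_span (x i))].

Definition regular_pseudo_oval (pi : 'I_(#|F| ^ n).+1 -> {vspace V}) : Prop :=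
  exists g : 'End(V), lker g = 0%VS /\ oval_descent (fun i => (g @: pi i)%VS).

End PseudoOvals.

(* Main.v *)
Require Import Defs.
From HB Require Import structures.
From mathcomp Require Import all_boot all_order all_fingroup all_algebra.
From mathcomp Require Import all_solvable all_field.
From mathcomp Require Import ring zify.

(** If O is regular, then V carries an F_(q^n)-space structure whose points
    include the members of O, and a count shows that the tangent spaces are
    lines for it; the regulus through three members of Delta_i is then a
    subline over F of the projective line of V / pi_i.

    Conversely, as q is even, all tangent spaces share an n-dimensional nucleus
    N. In coordinates with pi_oo = {(0, 0, z)} and N = {(0, y, 0)}, the other
    members of O are the {(x, x a, x g(a))}. Regularity of Delta_oo says that
    the matrices a form a field K: a spread set closed under taking F-lines,
    together with its set of inverses, is closed under powers by Hua's identity,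
    hence equals F[a] for every nonscalar a, as n is prime. Likewise the slopes
    (a - b)^-1 (g(a) - g(b)) seen from the point b form a field R_b, up to a
    right factor. If R_b = R_c for some b <> c, then R_b = K and g has values in
    K s for some s, so O is a field reduction. Otherwise R_b and R_c always meet
    in F, which makes g map F-lines to F-lines; then g is additive, and all the
    R_b coincide, a contradiction. *)

(** The hypothesis h > 1 supplies a scalar t other than 0 and 1. Over F_2 every set of matrices is
    closed under affine lines, so closure would say nothing; for q > 2 it turns a set containing 0
    into an F-subspace. A frame of V / pi_i adapted to two members of Delta_i represents the other
    members by invertible matrices, and exchanging the two members inverts these matrices. This is
    why regularity also controls the set of inverses, as Hua's identity requires. The obstacle is
    that g(a) need not commute with K, so that left and right factors must be kept apart and K and
    the R_b are at first unrelated. They are compared through the slope of the pair b, c, which is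
    the same seen from b and from c and serves to normalise both R_b and R_c. *)

Set Implicit Arguments.
Unset Strict Implicit.
Unset Printing Implicit Defensive.

Import GRing.Theory.
Local Open Scope ring_scope.

(** * Fields of matrices *)

Section Eigenvalue.

Variables (F : finFieldType) (L : splittingFieldType F) (m : nat).
Local Notation n := m.+1.
Local Notation q := #|F|.
Variable a : 'M[F]_n.
Hypothesis unit_poly :
  forall p : {poly F}, horner_mx a p = 0 \/ horner_mx a p \in unitmx.

(** The group generated by [a] acts semiregularly on the nonzero row vectors: if x a^k = x with x
    nonzero, then a^k - 1 is singular, hence 0 by [unit_poly]. So the order of [a] divides q^n -
    1. *)
Lemma expr_card_unit : a != 0 -> a ^+ (q ^ n).-1 = 1.
Proof.
move=> a0.
have ua : a \in unitmx.
  by have := unit_poly 'X; rewrite horner_mx_X => -[] // e; rewrite e eqxx in a0.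
have mula_inj : injective (fun x : 'rV[F]_n => x *m a).
  exact: (can_inj (mulmxK ua)).
pose s := perm mula_inj.
have sX k (x : 'rV[F]_n) : (s ^+ k)%g x = x *m (a ^+ k).
  elim: k x => [|k IH] x; first by rewrite perm1 mulmx1.
  by rewrite expgSr permM IH permE exprSr mulmxA.
pose D : {set 'rV[F]_n} := [set~ 0].
have actD : [acts <[s]>%g, on D | 'P].
  rewrite gen_subG sub1set; apply/astabsP=> x /=; rewrite !inE.
  by rewrite /aperm permE (can2_eq (mulmxK ua) (mulmxKV ua)) mul0mx.
have orbD x : x \in D -> #|orbit 'P <[s]>%g x| = #[s]%g.
  rewrite !inE => x0; rewrite card_orbit.
  suff -> : ('C_<[s]>[x | 'P])%g = 1%g by rewrite indexg1.
  apply/eqP; rewrite -subG1; apply/subsetP=> t /setIP[/cycleP[k ->]].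
  move/astab1P; rewrite inE /= /aperm sX -[X in _ = X]mulmx1 => ak.
  have := unit_poly ('X^k - 1).
  rewrite rmorphB rmorphXn rmorph1 /= horner_mx_X => -[/subr0_eq e | u].
    by apply/eqP/permP=> y; rewrite sX perm1 e mulmx1.
  case/eqP: x0; apply: (can_inj (mulmxK u)).
  by rewrite mulmxBr ak subrr mul0mx.
have := card_uniform_partition _ (orbit_partition actD) => /(_ #[s]%g) cardD.
have {cardD} cardD : #|D| = (#|orbit 'P <[s]>%g @: D| * #[s]%g)%N.
  by apply: cardD => O /imsetP[x xD ->]; apply: orbD.
have : (s ^+ #|D|)%g = 1%g by rewrite cardD mulnC expgM expg_order expg1n.
rewrite cardsCs setCK cards1 card_mx mul1n subn1 => sq.
apply/row_matrixP => i; rewrite !rowE.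
by rewrite -sX sq perm1 mulmx1.
Qed.

Lemma card_finvect : #|finvect_type L| = (q ^ \dim {:L})%N.
Proof. have := card_vspace (fullv : {vspace finvect_type L}).
by move=> <-; apply: eq_card => x; rewrite (@memvf _ (finvect_type L)). Qed.

(** X^(q^n) - X annihilates [a] and is the product of the X - x over all x in [L], so some a - x is
    singular. *)
Lemma exists_eigenvalue : \dim {:L} = n ->
  exists l : L, exists2 w : 'rV[L]_n,
    w != 0 & w *m map_mx (in_alg L) a = l *: w.
Proof.
move=> dimL; pose aL : 'M[L]_n := map_mx (in_alg L) a.
have [a0|a0] := eqVneq a 0.
  exists 0, (const_mx 1).
    by apply/eqP=> /rowP/(_ 0); rewrite !mxE; apply/eqP; rewrite oner_neq0.
  by rewrite a0 map_mx0 mulmx0 scale0r.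
have qn_gt0 : (0 < q ^ n)%N by rewrite expn_gt0 (ltnW (finNzRing_gt1 F)).
have aq : aL ^+ (q ^ n) - aL = 0.
  rewrite -(prednK qn_gt0) exprS -rmorphXn /= expr_card_unit // map_mx1.
  by rewrite mulr1 subrr.
(* [finvect_type L] is [L] seen as a finite field, over whose elements the product can be taken. *)
have : horner_mx (aL : 'M[finvect_type L]_n) ('X^(q ^ n) - 'X) = 0.
  by rewrite rmorphB rmorphXn /= horner_mx_X.
have -> : (q ^ n)%N = #|finvect_type L| by rewrite card_finvect dimL.
rewrite finField_genPoly rmorph_prod /= => prod0.
have det0 : \prod_(x : finvect_type L) \det (aL - x%:M) = 0.
  transitivity (\det (\prod_(x : finvect_type L)
     horner_mx (aL : 'M[finvect_type L]_n) ('X - x%:P))).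
    elim/big_rec2: _ => [|x y1 y2 _ ->]; first by rewrite det1.
    by rewrite det_mulmx rmorphB /= horner_mx_X horner_mx_C.
  by rewrite prod0 det0.
have /prodf_eq0[x _ /det0P[w w0 /eqP]] := introT eqP det0.
by rewrite mulmxBr mul_mx_scalar subr_eq0 => /eqP wx; exists x, w.
Qed.

End Eigenvalue.

Section LineClosed.

Variables (F : fieldType) (V : lmodType F).

Definition line_closed (S : pred V) :=
  forall A B (t : F), S A -> S B -> S (A + t *: (B - A)).

Lemma line_closedZ S : line_closed S -> S 0 ->
  forall (t : F) A, S A -> S (t *: A).
Proof. by move=> lS S0 t A SA; have := lS _ _ t S0 SA; rewrite subr0 add0r. Qed.

(** A + B is the point with parameter t on the line joining (1 - t)^-1 A and t^-1 B. *)
Lemma line_closedD S (t : F) : t != 0 -> t != 1 -> line_closed S -> S 0 ->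
  forall A B, S A -> S B -> S (A + B).
Proof.
move=> t0 t1 lS S0 A B SA SB.
have := lS ((1 - t)^-1 *: A) (t^-1 *: B) t; rewrite !(line_closedZ lS) //.
move/(_ isT isT); rewrite scalerBr scalerA divff // scale1r addrCA.
rewrite [t *: (_ *: A)]scalerA -scalerBl -[X in X - _]mul1r -mulrBl.
by rewrite divff ?subr_eq0 1?eq_sym // scale1r addrC.
Qed.

End LineClosed.

Section MatrixFields.

Variables (F : finFieldType) (m : nat).
Local Notation n := m.+1.
Local Notation q := #|F|.
Implicit Types (A B a b : 'M[F]_n) (S R : {set 'M[F]_n}).

(** Only polynomials in a single element are required, because Hua's identity gives powers but not
    products of two elements. For n prime, one nonscalar element generates [R], and closure under
    sums, products and inverses follows. *)
Definition mxfield R := [/\ #|R| = (q ^ n)%N,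
  forall A, A \in R -> A = 0 \/ A \is a GRing.unit
  & forall a (p : {poly F}), a \in R -> horner_mx a p \in R].

Section Hua.

Variable R : {set 'M[F]_n}.
Hypothesis unitR : forall A, A \in R -> A = 0 \/ A \is a GRing.unit.
Hypothesis R1 : 1 \in R.
Hypothesis RD : forall A B, A \in R -> B \in R -> A + B \in R.
Hypothesis RZ : forall (t : F) A, A \in R -> t *: A \in R.
Hypothesis invRD : forall A B, A^-1 \in R -> B^-1 \in R -> (A + B)^-1 \in R.

Let RN A : A \in R -> - A \in R.
Proof. by rewrite -scaleN1r; apply: RZ. Qed.

Let RB A B : A \in R -> B \in R -> A - B \in R.
Proof. by move=> AR BR; rewrite RD ?RN. Qed.

(* Hua's identity: a - a b^-1 a = (a^-1 + (b - a)^-1)^-1. *)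
Let hua a b : a \in R -> b \in R -> b \is a GRing.unit ->
  a * b^-1 * a \in R.
Proof.
move=> aR bR ub.
have [-> | ua] := unitR aR; first by rewrite mulr0 -(subrr 1) RB.
have [/eqP | uba] := unitR (RB bR aR).
  by rewrite subr_eq0 => /eqP <-; rewrite divrr ?mul1r.
have e : (b - a) * b^-1 * a = a - a * b^-1 * a.
  by rewrite mulrBl divrr // mulrBl mul1r.
have i : a^-1 + (b - a)^-1 = ((b - a) * b^-1 * a)^-1.
  rewrite !invrM ?unitrMr ?unitrV // invrK mulrA.
  apply: (mulrI ua); apply: (mulIr uba).
  rewrite [a * (_ + _)]mulrDr divrr // [LHS]mulrDl mul1r mulrVK // subrK.
  by rewrite !mulrA divrr // mul1r mulrVK.
suff h : a - a * b^-1 * a \in R by have := RB aR h; rewrite opprB addrC subrK.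
by rewrite -e -[_ * a]invrK -i invRD // invrK // RB.
Qed.

Lemma hua_mxfield : #|R| = (q ^ n)%N -> mxfield R.
Proof.
move=> cardR; split=> // a p aR.
have invR b : b \in R -> b^-1 \in R.
  move=> bR; have [b0 | ub] := unitR bR; last first.
    by have := hua R1 bR ub; rewrite mul1r mulr1.
  by rewrite invr_out // b0 unitr0.
have powR k : a ^+ k \in R.
  (* Hua's identity raises the exponent by two, as a (a^k) a = a^(k+2), so two consecutive powers
     are carried along. *)
  suff : (a ^+ k \in R) && (a ^+ k.+1 \in R) by case/andP.
  elim: k => [|k /andP[IH1 IH2]]; first by rewrite R1 expr1.
  rewrite IH2 /=; have [a0 | ua] := unitR aR.
    by rewrite a0 exprS mul0r -(subrr 1) RB.
  have := hua aR (invR _ IH1); rewrite unitrV unitrX // invrK -exprS -exprSr.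
  exact.
rewrite -[p]coefK poly_def rmorph_sum /=.
elim/big_ind: _ => [|//|i _]; first by rewrite -(subrr 1) RB.
by rewrite linearZ /= rmorphXn /= horner_mx_X RZ.
Qed.

End Hua.

(** Right division by [s] brings 1 into the set and keeps both closures: the A with A^-1 in the new
    set are the s B with B^-1 in [S], and left multiplication by [s] preserves F-lines. *)
Lemma spread_set_mxfield S s (t : F) : t != 0 -> t != 1 ->
  #|S| = (q ^ n)%N -> 0 \in S ->
  (forall A, A \in S -> A = 0 \/ A \is a GRing.unit) ->
  line_closed (mem S) -> line_closed (fun A => A^-1 \in S) ->
  s \in S -> s != 0 -> mxfield [set A * s^-1 | A in S].
Proof.
move=> t0 t1 cardS S0 unitS lS lS' sS s0.
have us : s \is a GRing.unit by case: (unitS _ sS) => // /eqP; rewrite (negPf s0).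
have memR A : (A \in [set A * s^-1 | A in S]) = (A * s \in S).
  apply/imsetP/idP => [[B BS ->]|]; first by rewrite divrK.
  by move=> As; exists (A * s); rewrite ?mulrK.
have memR' A : (A^-1 \in [set A * s^-1 | A in S]) = ((s^-1 * A)^-1 \in S).
  rewrite memR; have [uA | uA] := boolP (A \is a GRing.unit).
    by rewrite invrM ?unitrV // invrK.
  (* A matrix that is not invertible is its own [^-1] by convention; membership on either side then
     forces it to be 0. *)
  have eA X : (X * s \in S) -> X \isn't a GRing.unit -> X = 0.
    move=> XS; case: (unitS _ XS) => [Xs0 _|]; last by rewrite unitrMl // => ->.
    by rewrite -[X](mulrK us) Xs0 mul0r.
  have eA' X : (X \in S) -> X \isn't a GRing.unit -> X = 0.
    by move=> XS; case: (unitS _ XS) => // ->.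
  have V0 : 0^-1 = 0 :> 'M[F]_n by rewrite invr_out ?unitr0.
  apply/idP/idP => [/eA | /eA'].
    rewrite unitrV => /(_ uA) A0; rewrite -[A]invrK A0 V0 mulr0 V0 //.
  rewrite unitrV unitrMr ?unitrV // => /(_ uA) /(canRL invrK).
  rewrite V0 => /(congr1 (fun X => s * X)); rewrite mulVKr // mulr0 => ->.
  by rewrite V0 mul0r.
apply: hua_mxfield.
- move=> A; rewrite memR => /unitS[As0|]; last by rewrite unitrMl //; right.
  by left; rewrite -[A](mulrK us) As0 mul0r.
- by rewrite memR mul1r.
- by move=> A B; rewrite !memR mulrDl; apply: line_closedD t0 t1 lS S0 _ _.
- by move=> c A; rewrite !memR -scalerAl; apply: line_closedZ.
- move=> A B; rewrite !memR' mulrDr; apply: line_closedD t0 t1 lS' _ _ _.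
  by rewrite invr_out ?unitr0.
by rewrite card_imset //; apply: (can_inj (mulrVK us)).
Qed.

End MatrixFields.

(** * Generation of matrix fields of prime degree by one element *)

Section MatrixFieldTheory.

Variables (F : finFieldType) (L : splittingFieldType F) (m : nat).
Local Notation n := m.+1.
Local Notation q := #|F|.
Implicit Types (A B a b : 'M[F]_n) (R : {set 'M[F]_n}).
Hypotheses (dimL : \dim {:L} = n) (prime_n : prime n).

Lemma mxfield_unit_poly R a : mxfield R -> a \in R ->
  forall p : {poly F}, horner_mx a p = 0 \/ horner_mx a p \in unitmx.
Proof. by move=> [_ uR pR] aR p; apply: uR; apply: pR. Qed.

Lemma horner_mx_eigen k (a : 'M[L]_k.+1) (w : 'rV[L]_k.+1) (l : L) p :
  w *m a = l *: w -> w *m horner_mx a p = p.[l] *: w.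
Proof.
move=> wa; elim/poly_ind: p => [|p c IH].
  by rewrite rmorph0 mulmx0 horner0 scale0r.
rewrite rmorphD rmorphM /= horner_mx_X horner_mx_C mulmxDr mulmxA IH.
by rewrite -scalemxAl wa mul_mx_scalar scalerA -scalerDl hornerMXaddC.
Qed.

(** An eigenvalue c in F would make a - c singular, hence 0, and [a] scalar. As n is prime, an
    eigenvalue outside F generates [L]. *)
Lemma nonscalar_eigen a :
    (forall p : {poly F}, horner_mx a p = 0 \/ horner_mx a p \in unitmx) ->
    ~~ is_scalar_mx a ->
  exists l : L, exists w : 'rV[L]_n, [/\ w != 0,
    w *m map_mx (in_alg L) a = l *: w & <<1; l>>%VS = fullv].
Proof.
move=> ua nsa; have [l [w w0 wa]] := exists_eigenvalue ua dimL.
exists l, w; split=> //.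
have lF : l \notin 1%VS.
  apply: contra nsa => /vlineP[c lc].
  have ec : horner_mx a ('X - c%:P) = a - c%:M.
    by rewrite rmorphB /= horner_mx_X horner_mx_C.
  have [|] := ua ('X - c%:P); rewrite ec.
    by move/subr0_eq->; apply/is_scalar_mxP; exists c.
  move=> uac; case/eqP: w0.
  have : map_mx (in_alg L) (a - c%:M) \in unitmx by rewrite map_unitmx.
  move/mulmxK => /(_ _ w) <-.
  by rewrite map_mxB mulmxBr wa map_scalar_mx mul_mx_scalar lc subrr mul0mx.
apply/eqP; rewrite eqEdim subvf /= dimL.
have [_ pr] := primeP prime_n.
have := field_dimS (subvf <<1; l>>%AS); rewrite dimL => /pr.
move=> /orP[] /eqP; last by move=> -> .
move=> d1.
case/negP: lF.
have/eqP -> : (1%VS == <<1; l>>%VS :> {vspace L}).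
  by rewrite eqEdim subv_adjoin dimv1 d1.
exact: memv_adjoin.
Qed.

(** A polynomial that kills [a] kills its eigenvalue, whose minimal polynomial over F has degree
    n. *)
Lemma horner_mx_eq0_small a (p : {poly F}) :
    (forall p : {poly F}, horner_mx a p = 0 \/ horner_mx a p \in unitmx) ->
    ~~ is_scalar_mx a -> (size p <= n)%N -> horner_mx a p = 0 -> p = 0.
Proof.
move=> ua nsa sp pa0; have [l [w [w0 wa lL]]] := nonscalar_eigen ua nsa.
have rl : root (map_poly (in_alg L) p) l.
  have := horner_mx_eigen (map_poly (in_alg L) p) wa.
  rewrite -map_horner_mx pa0 map_mx0 mulmx0 => /esym/eqP.
  by rewrite scaler_eq0 (negPf w0) orbF.
have pO : map_poly (in_alg L) p \is a polyOver 1%VS.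
  by apply/polyOver1P; exists p.
have := minPoly_dvdp pO rl.
have [// | p0] := eqVneq p 0.
move/dvdp_leq; rewrite map_poly_eq0 => /(_ p0).
rewrite size_map_poly size_minPoly adjoin_degreeE lL dimL dimv1 divn1.
by rewrite leqNgt ltnS sp.
Qed.

(** The q^n polynomials of degree less than n in [a] are distinct elements of [R], hence exhaust
    it. *)
Lemma mxfield_gen R a B : mxfield R -> a \in R -> ~~ is_scalar_mx a ->
  B \in R -> exists p, B = horner_mx a p.
Proof.
move=> fR aR nsa BR; have ua := mxfield_unit_poly fR aR.
case: fR => cR uR pR.
pose f (v : 'rV[F]_n) := horner_mx a (rVpoly v).
have f_inj : injective f.
  move=> u v fuv; apply/eqP; rewrite -subr_eq0 -[_ - _]rVpolyK.
  rewrite (horner_mx_eq0_small ua nsa _ (_ : horner_mx a (rVpoly (u - v)) = 0)).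
  - by rewrite linear0.
  - exact: size_poly.
  by rewrite linearB rmorphB /= -/(f u) -/(f v) fuv subrr.
have fR : f @: [set: 'rV[F]_n] = R.
  apply/eqP; rewrite eqEcard card_imset // cardsT card_mx mul1n cR leqnn andbT.
  by apply/subsetP => _ /imsetP[v _ ->]; apply: pR.
by move: BR; rewrite -fR => /imsetP[v _ ->]; exists (rVpoly v).
Qed.

Lemma mxfield_eq R R' a : mxfield R -> mxfield R' -> a \in R -> a \in R' ->
  ~~ is_scalar_mx a -> R = R'.
Proof.
move=> fR fR' aR aR' nsa; apply/setP=> B; apply/idP/idP.
  by case/(mxfield_gen fR aR nsa)=> p ->; case: fR' => _ _; apply.
by case/(mxfield_gen fR' aR' nsa)=> p ->; case: fR => _ _; apply.
Qed.

Lemma mxfield_nonscalar R : mxfield R ->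
  exists2 a, a \in R & ~~ is_scalar_mx a.
Proof.
case=> cR _ _; have [/existsP[a /andP[aR nsa]] | ] :=
  boolP [exists a, (a \in R) && ~~ is_scalar_mx a]; first by exists a.
rewrite negb_exists => /forallP sR.
have : (#|R| <= #|[set (c%:M : 'M[F]_n) | c : F]|)%N.
  apply/subset_leq_card/subsetP=> a aR; have := sR a; rewrite aR negbK.
  by case/is_scalar_mxP=> c ->; apply/imsetP; exists c.
move=> /leq_trans/(_ (leq_imset_card _ _)); rewrite cR -{2}(expn1 q).
by rewrite leq_exp2l ?finNzRing_gt1 // leqNgt prime_gt1.
Qed.

Section Closure.

Variable R : {set 'M[F]_n}.
Hypothesis fR : mxfield R.

Let gen : exists a, forall B, B \in R <-> exists p, B = horner_mx a p.
Proof.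
have [a aR nsa] := mxfield_nonscalar fR; exists a => B; split.
  exact: mxfield_gen.
by case=> p ->; case: fR => _ _; apply.
Qed.

Lemma mxfieldD A B : A \in R -> B \in R -> A + B \in R.
Proof.
have [a ga] := gen; move=> /ga[p ->] /ga[r ->]; apply/ga; exists (p + r).
by rewrite rmorphD.
Qed.

Lemma mxfieldM A B : A \in R -> B \in R -> A * B \in R.
Proof.
have [a ga] := gen; move=> /ga[p ->] /ga[r ->]; apply/ga; exists (p * r).
by rewrite rmorphM.
Qed.

Lemma mxfield_scalar (c : F) : c%:M \in R.
Proof. by have [a ga] := gen; apply/ga; exists c%:P; rewrite horner_mx_C. Qed.

Lemma mxfield0 : 0 \in R.
Proof. by have := mxfield_scalar 0; rewrite raddf0. Qed.

Lemma mxfield1 : 1 \in R.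
Proof. exact: (mxfield_scalar 1). Qed.

Lemma mxfieldZ (c : F) A : A \in R -> c *: A \in R.
Proof. by move=> AR; rewrite -mul_scalar_mx mxfieldM ?mxfield_scalar. Qed.

Lemma mxfieldB A B : A \in R -> B \in R -> A - B \in R.
Proof. by move=> AR BR; rewrite mxfieldD // -scaleN1r mxfieldZ. Qed.

(** The inverse of a nonzero [A] is its power with exponent q^n - 2. *)
Lemma mxfieldV A : A \in R -> A^-1 \in R.
Proof.
move=> AR; have [A0 | A0] := eqVneq A 0.
  by rewrite invr_out A0 ?unitr0 // mxfield0.
have uA : A \is a GRing.unit.
  by case: fR => _ uR _; case: (uR _ AR) => // /eqP; rewrite (negPf A0).
have := expr_card_unit (mxfield_unit_poly fR AR) A0.
have [k ->] : exists k, (q ^ n).-1 = k.+1.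
  exists (q ^ n).-2; rewrite prednK // -ltnS prednK ?expn_gt0 ?(ltnW (finNzRing_gt1 F)) //.
  by rewrite -[X in (X < _)%N](exp1n n) ltn_exp2r // finNzRing_gt1.
rewrite exprS => /(congr1 (fun X => A^-1 * X)); rewrite mulKr // mulr1 => <-.
have := mxfield1; elim: k => [|k IH] h; first by rewrite expr0.
by rewrite exprS mxfieldM // IH.
Qed.

End Closure.

End MatrixFieldTheory.

(* The affine form of the fundamental theorem of projective geometry, for an  *)
(* injective map which sends lines to lines and 0 to 0.                       *)
Section LinePreserving.

Variables (F : finFieldType) (U V : lmodType F) (K : pred U) (g : U -> V).
Variable t : F.
Hypotheses (t0 : t != 0) (t1 : t != 1).
Hypothesis KD : forall a b, K a -> K b -> K (a + b).
Hypothesis KZ : forall (c : F) a, K a -> K (c *: a).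
Hypothesis ginj : forall a b, K a -> K b -> g a = g b -> a = b.
Hypothesis g0 : g 0 = 0.
Hypothesis gline : forall b c, K b -> K c -> forall u : F,
  exists v, g (b + u *: (c - b)) = g b + v *: (g c - g b).
Hypothesis Kdim : forall a, K a -> exists2 b, K b & forall u, b != u *: a.

Let KB a b : K a -> K b -> K (a - b).
Proof. by move=> Ka Kb; rewrite -scaleN1r; apply: KD => //; apply: KZ. Qed.

(** The induced map between the parameters of the two lines is an injection of the finite field F
    into itself, hence onto. *)
Lemma line_onto b c : K b -> K c -> b != c -> forall v : F,
  exists u, g (b + u *: (c - b)) = g b + v *: (g c - g b).
Proof.
move=> Kb Kc bc v.
have ex u : exists v, g (b + u *: (c - b)) == g b + v *: (g c - g b).
  by have [w ->] := gline Kb Kc u; exists w.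
pose f u := xchoose (ex u).
have fE u : g (b + u *: (c - b)) = g b + f u *: (g c - g b).
  exact/eqP/(xchooseP (ex u)).
have f_inj : injective f.
  move=> u u' fu; have : b + u *: (c - b) = b + u' *: (c - b).
    by apply: ginj; rewrite ?fE ?fu //; apply/KD/KZ/KB.
  move/addrI/eqP; rewrite -subr_eq0 -scalerBl scaler_eq0 [c - b == 0]subr_eq0.
  by rewrite [c == b]eq_sym (negPf bc) orbF subr_eq0 => /eqP.
by have /codomP[u ->] := injF_onto f_inj v; exists u.
Qed.

Let K0 a : K a -> K 0.
Proof. by move=> Ka; rewrite -(scale0r a); apply: KZ. Qed.

Lemma line0_onto a : K a -> forall v : F, exists u, g (u *: a) = v *: g a.
Proof.
move=> Ka v; have [-> | a0] := eqVneq a 0.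
  by exists 0; rewrite scaler0 g0 scaler0.
have [|u] := line_onto (K0 Ka) Ka _ v; first by rewrite eq_sym.
by rewrite g0 !subr0 !add0r; exists u.
Qed.

Lemma line0_pres a : K a -> forall u : F, exists v, g (u *: a) = v *: g a.
Proof.
move=> Ka u; have [v] := gline (K0 Ka) Ka u.
by rewrite g0 !subr0 !add0r; exists v.
Qed.

(** If x were not 1, the line through g(a) and g(a + b) would meet F g(b). The preimage of the
    common point would lie on both a + F b and F b, which are parallel and distinct. *)
Let coef1 a b (x y : F) : K a -> K b -> (forall u, a != u *: b) ->
  g (a + b) = x *: g a + y *: g b -> x = 1.
Proof.
move=> Ka Kb ab gab; apply/eqP; rewrite -subr_eq0; apply/negP => /negP x1.
have ab' : a != a + b.
  apply/eqP => /esym/eqP; rewrite -subr_eq0 addrAC subrr add0r => /eqP b0.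
  have /eqP := x1; case.
  have : g (a + b) = g a by rewrite b0 addr0.
  rewrite gab b0 g0 scaler0 addr0 => /eqP; rewrite -subr_eq0 -{2}[g a]scale1r.
  rewrite -scalerBl scaler_eq0 => /orP[/eqP // | /eqP ga0].
  have := ab 0; rewrite scale0r => /eqP[].
  by apply: (ginj Ka (K0 Ka)); rewrite ga0 g0.
have [u] := line_onto Ka (KD Ka Kb) ab' (- (x - 1)^-1).
rewrite (_ : a + b - a = b) ?gab; last by rewrite addrAC subrr add0r.
have -> : x *: g a + y *: g b - g a = (x - 1) *: g a + y *: g b.
  by rewrite scalerBl scale1r addrAC.
rewrite scalerDr scalerA mulNr mulVf // scaleN1r addrA subrr add0r scalerA.
have [u' <-] := line0_onto Kb (- (x - 1)^-1 * y).
move/(ginj (KD Ka (KZ _ Kb)) (KZ _ Kb))/(canRL (addrK _)).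
by rewrite -scalerBl => e; have /eqP[] := ab (u' - u).
Qed.

Let addI a b : K a -> K b -> (forall u, a != u *: b) -> (forall u, b != u *: a) ->
  g (a + b) = g a + g b.
Proof.
move=> Ka Kb ab ba.
(* The point a + b lies on the line joining (1 - t)^-1 a and t^-1 b, whose images are multiples of
   g(a) and g(b). *)
have [x [y gab]] : exists x y, g (a + b) = x *: g a + y *: g b.
  have [v] := gline (KZ (1 - t)^-1 Ka) (KZ t^-1 Kb) t.
  have [x ->] := line0_pres Ka (1 - t)^-1.
  have [y ->] := line0_pres Kb t^-1.
  have -> : (1 - t)^-1 *: a + t *: (t^-1 *: b - (1 - t)^-1 *: a) = a + b.
    rewrite scalerBr scalerA divff // scale1r addrCA.
    rewrite [t *: (_ *: a)]scalerA -scalerBl -[X in X - _]mul1r -mulrBl.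
    by rewrite divff ?subr_eq0 1?eq_sym // scale1r addrC.
  move->; exists (x - v * x), (v * y).
  by rewrite scalerBr !scalerA scalerBl addrCA addrC.
have x1 := coef1 Ka Kb ab gab.
have y1 : y = 1 by apply: (coef1 Kb Ka ba (y := x)); rewrite addrC gab addrC.
by rewrite gab x1 y1 !scale1r.
Qed.

Lemma line_pres_additive a b : K a -> K b -> g (a + b) = g a + g b.
Proof.
move=> Ka Kb.
have [-> | a0] := eqVneq a 0; first by rewrite g0 !add0r.
have [-> | b0] := eqVneq b 0; first by rewrite g0 !addr0.
have indep (c d : U) :
    d != 0 -> (forall u : F, c != u *: d) -> forall u : F, d != u *: c.
  move=> d0 cd u; apply/eqP => dc; have [u0 | u0] := eqVneq u 0.
    by case/eqP: d0; rewrite dc u0 scale0r.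
  by have /eqP[] := cd u^-1; rewrite dc scalerA mulVf // scale1r.
have [/existsP[u /eqP ab] | ] := boolP [exists u, b == u *: a]; last first.
  rewrite negb_exists => /forallP ab; apply: addI => //.
  exact: indep.
have u0 : u != 0 by apply: contra b0 => /eqP u0; rewrite ab u0 scale0r.
(* For dependent [a] and [b], a vector [c] outside F a allows g(a + b + c) to be expanded in two
   ways by the independent case. *)
have [c Kc ca] := Kdim Ka.
have c0 : c != 0 by have := ca 0; rewrite scale0r.
have ac := indep _ _ a0 ca.
have cu (v : F) : v != 0 -> forall w, c != w *: (v *: a).
  by move=> _ w; rewrite scalerA.
have uc (v : F) : v != 0 -> forall w, v *: a != w *: c.
  move=> v0 w; apply/negP => /eqP/(congr1 (fun z => v^-1 *: z)).
  by rewrite !scalerA mulVf // scale1r => e; have /eqP[] := ac (v^-1 * w).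
have Ku := KZ u Ka.
have e1 : g (a + b + c) = g a + (g b + g c).
  rewrite ab -addrA -(addI Ku Kc (uc u u0) (cu u u0)).
  apply: (addI Ka (KD Ku Kc)) => w; apply/eqP => aw.
    have w0 : w != 0 by apply: contra a0 => /eqP w0; rewrite aw w0 scale0r.
    suff : c = (w^-1 - u) *: a by apply/eqP.
    by rewrite scalerBl {1}aw scalerA mulVf // scale1r addrAC subrr add0r.
  suff : c = (w - u) *: a by apply/eqP.
  by rewrite scalerBl -aw addrAC subrr add0r.
have e2 : g (a + b + c) = g (a + b) + g c.
  have -> : a + b = (1 + u) *: a by rewrite ab scalerDl scale1r.
  have [-> | v0] := eqVneq (1 + u) 0; first by rewrite scale0r g0 !add0r.
  by apply: addI; [apply: KZ | | apply: uc | apply: cu].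
by move: e1; rewrite e2 addrA => /addIr.
Qed.

End LinePreserving.

(** * Slope fields *)

Section SlopeFields.

Variables (F : finFieldType) (L : splittingFieldType F) (m : nat).
Local Notation n := m.+1.
Local Notation q := #|F|.
Hypotheses (dimL : \dim {:L} = n) (prime_n : prime n).
Variable t : F.
Hypotheses (t0 : t != 0) (t1 : t != 1).
Variables (K : {set 'M[F]_n}) (g : 'M[F]_n -> 'M[F]_n).
Hypothesis fK : mxfield K.

(* For a = b this is 0^-1 * 0 = 0. *)
Definition slope (a b : 'M[F]_n) := (a - b)^-1 * (g a - g b).

Definition slopes b := [set slope a b | a in K].

Hypothesis g0 : g 0 = 0.
Hypothesis gunit : forall a b, a \in K -> b \in K -> a != b ->
  g a - g b \is a GRing.unit.
Hypothesis slope_inj : forall b, b \in K -> {in K &, injective (slope^~ b)}.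
Hypothesis slopes_line : forall b, b \in K -> line_closed (mem (slopes b)).
Hypothesis slopes_invline : forall b, b \in K ->
  line_closed (fun A => A^-1 \in slopes b).

Let KB a b : a \in K -> b \in K -> a - b \in K.
Proof. exact: (mxfieldB dimL prime_n fK). Qed.

Let unitK a : a \in K -> a != 0 -> a \is a GRing.unit.
Proof.
by case: fK => _ uK _ aK; case: (uK a aK) => // ->; rewrite eqxx.
Qed.

Lemma slope_self b : slope b b = 0.
Proof. by rewrite /slope !subrr mulr0. Qed.

Lemma slopeC a b : slope a b = slope b a.
Proof. by rewrite /slope -[a - b]opprB -[g a - g b]opprB invrN mulrNN. Qed.

Lemma slope_unit a b : a \in K -> b \in K -> a != b ->
  slope a b \is a GRing.unit.
Proof.
move=> aK bK ab; rewrite unitrMr ?gunit // unitrV unitK ?KB //.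
by rewrite subr_eq0.
Qed.

Lemma slopeK a b : a \in K -> b \in K -> (a - b) * slope a b = g a - g b.
Proof.
move=> aK bK; have [-> | ab] := eqVneq a b; first by rewrite !subrr mul0r.
by rewrite mulVKr // unitK ?KB // subr_eq0.
Qed.

Definition slope_field b s := [set A * s^-1 | A in slopes b].

Lemma mxfield_slope_field b c : b \in K -> c \in K -> c != b ->
  mxfield (slope_field b (slope c b)).
Proof.
move=> bK cK cb; apply: (spread_set_mxfield t0 t1).
- by rewrite card_in_imset; [case: fK | apply: slope_inj].
- by apply/imsetP; exists b; rewrite ?slope_self.
- move=> _ /imsetP[a aK ->]; have [-> | ab] := eqVneq a b.
    by left; rewrite slope_self.
  by right; apply: slope_unit.
- exact: slopes_line.
- exact: slopes_invline.
- exact: imset_f.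
by apply: contraTneq (slope_unit cK bK cb) => ->; rewrite unitr0.
Qed.

Lemma mem_slope_field a b s : a \in K -> slope a b * s^-1 \in slope_field b s.
Proof. by move=> aK; apply/imsetP; exists (slope a b) => //; apply: imset_f. Qed.

(** With k and l the slopes of a seen from b and c, both (a - b)(k - l) and (c - b)(s - l) equal
    g(c) - g(b) - (c - b) l. Hence (c - b)^-1 (a - b) is a quotient of elements of the common field,
    and every element of K has this form. *)
Lemma slope_field_eq_K b c : b \in K -> c \in K -> c != b ->
  slope_field b (slope c b) = slope_field c (slope c b) ->
  K = slope_field b (slope c b).
Proof.
move=> bK cK cb; set s := slope c b; set R := slope_field b s => eR.
have fR : mxfield R := mxfield_slope_field bK cK cb.
have us : s \is a GRing.unit := slope_unit cK bK cb.
have ucb : c - b \is a GRing.unit by rewrite unitK ?KB // subr_eq0.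
have RB := mxfieldB dimL prime_n fR.
have quoR a : a \in K -> (c - b)^-1 * (a - b) \in R.
  move=> aK; have [-> | ac] := eqVneq a c.
    by rewrite mulVr // (mxfield1 dimL prime_n fR).
  have [-> | ab] := eqVneq a b.
    by rewrite subrr mulr0 (mxfield0 dimL prime_n fR).
  pose k := slope a b; pose l := slope a c.
  have kR : k * s^-1 \in R by apply: mem_slope_field.
  have lR : l * s^-1 \in R by rewrite eR; apply: mem_slope_field.
  have e : (a - b) * (k - l) = (c - b) * (s - l).
    rewrite !mulrBr (slopeK aK bK) (slopeK cK bK).
    have -> : (a - b) * l = g a - g c + (c - b) * l.
      by rewrite -(slopeK aK cK) -mulrDl addrA subrK.
    by rewrite opprD addrA opprB [_ + (g c - g a)]addrC addrA subrK.
  have usl : s - l \is a GRing.unit.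
    have [_ uR _] := fR.
    have : (s - l) * s^-1 \in R.
      by rewrite mulrBl RB // divrr // (mxfield1 dimL prime_n fR).
    case/uR => [|]; last by rewrite unitrMl ?unitrV.
    move/(congr1 (fun X => X * s)); rewrite divrK // mul0r => /subr0_eq sl.
    have /esym/eqP := slope_inj cK bK aK (etrans (slopeC b c) sl).
    by rewrite (negPf ab).
  have ukl : k - l \is a GRing.unit.
    have uab : a - b \is a GRing.unit by rewrite unitK ?KB // subr_eq0.
    by rewrite -(unitrMr (k - l) uab) e unitrMr.
  have -> : (c - b)^-1 * (a - b) = (s - l) * s^-1 * ((k - l) * s^-1)^-1.
    rewrite invrM ?unitrV // invrK mulrA divrK //.
    by apply: (mulIr ukl); rewrite divrK // -mulrA e mulKr.
  apply: (mxfieldM dimL prime_n fR); last apply: (mxfieldV dimL prime_n fR).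
    by rewrite mulrBl RB // divrr // (mxfield1 dimL prime_n fR).
  by rewrite mulrBl RB.
apply/eqP; rewrite eqEcard; case: fK (fR) => -> _ _ [-> _ _]; rewrite leqnn andbT.
apply/subsetP=> x xK.
have := quoR (b + (c - b) * x); rewrite addrAC subrr add0r mulKr //; apply.
by rewrite (mxfieldD dimL prime_n fK) // (mxfieldM dimL prime_n fK) // KB.
Qed.

(** For a on the F-line through b and c, the matrix [M] is both u (slope a b) s^-1 and 1 + (u -
    1)(slope a c) s^-1, so it lies in both fields. As these differ, [M] is a scalar, and so is its
    conjugate (g(a) - g(b)) (g(c) - g(b))^-1. *)
Lemma slope_fields_distinct_line b c (u : F) :
    b \in K -> c \in K -> c != b ->
    slope_field b (slope c b) != slope_field c (slope c b) ->
  exists v : F, g (b + u *: (c - b)) = g b + v *: (g c - g b).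
Proof.
move=> bK cK cb; set s := slope c b => nR.
have [-> | u0] := eqVneq u 0; first by exists 0; rewrite !scale0r !addr0.
have [-> | u1] := eqVneq u 1.
  by exists 1; rewrite !scale1r addrCA subrr addr0 addrCA subrr addr0.
set a := b + u *: (c - b).
have aK : a \in K.
  by rewrite (mxfieldD dimL prime_n fK) // (mxfieldZ dimL prime_n fK) // KB.
have ucb : c - b \is a GRing.unit by rewrite unitK ?KB // subr_eq0.
have ug : g c - g b \is a GRing.unit by apply: gunit.
pose M := (c - b)^-1 * (g a - g b) * (g c - g b)^-1 * (c - b).
have sV : s^-1 = (g c - g b)^-1 * (c - b).
  by rewrite invrM ?unitrV // invrK.
have us : s \is a GRing.unit := slope_unit cK bK cb.
have fb := mxfield_slope_field bK cK cb.
have fc : mxfield (slope_field c s).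
  by rewrite /s slopeC; apply: mxfield_slope_field => //; rewrite eq_sym.
have MRb : M \in slope_field b s.
  have <- : u *: (slope a b * s^-1) = M.
    rewrite sV /slope /M {1}/a addrAC subrr add0r.
    by rewrite invrZ ?unitfE // -!scalerAl scalerA divff // scale1r !mulrA.
  exact: (mxfieldZ dimL prime_n fb u (mem_slope_field b s aK)).
have MRc : M \in slope_field c s.
  have ac : a - c = (u - 1) *: (c - b).
    by rewrite scalerBl scale1r opprB addrA /a [b + _]addrC.
  have <- : (u - 1) *: (slope a c * s^-1) + 1 = M.
    rewrite sV /slope ac invrZ ?unitfE ?subr_eq0 // -!scalerAl scalerA.
    rewrite divff ?subr_eq0 // scale1r /M.
    have -> : g a - g c = (g a - g b) - (g c - g b).
      by rewrite opprB addrA subrK.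
    by rewrite [_^-1 * (_ - _)]mulrBr mulrBl !mulrA mulrK // mulVr // subrK.
  apply: (mxfieldD dimL prime_n fc); last exact: (mxfield1 dimL prime_n fc).
  exact: (mxfieldZ dimL prime_n fc (u - 1) (mem_slope_field c s aK)).
have [/is_scalar_mxP[v Mv] | nsM] := boolP (is_scalar_mx M); last first.
  by case/eqP: nR; apply: (mxfield_eq dimL prime_n fb fc MRb MRc).
exists v; apply/eqP; rewrite addrC -subr_eq; apply/eqP.
have : (c - b) * M = (g a - g b) * (g c - g b)^-1 * (c - b).
  by rewrite /M -!mulrA mulVKr.
rewrite Mv [LHS]mul_mx_scalar -[X in v *: X]mul1r scalerAl.
move/(mulIr ucb)/(congr1 (fun X => X * (g c - g b))); rewrite divrK //.
by rewrite -scalerAl mul1r.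
Qed.

Lemma slopes_common_field :
  exists2 s, s \is a GRing.unit & forall a, a \in K -> g a * s^-1 \in K.
Proof.
have [/existsP[b /existsP[c /and4P[bK cK cb /eqP eR]]] | nR] := boolP
  [exists b, exists c, [&& b \in K, c \in K, c != b &
    slope_field b (slope c b) == slope_field c (slope c b)]].
  exists (slope c b); first exact: slope_unit.
  have eK := slope_field_eq_K bK cK cb eR.
  have gab a : a \in K -> (g a - g b) * (slope c b)^-1 \in K.
    move=> aK; rewrite -(slopeK aK bK) -mulrA (mxfieldM dimL prime_n fK) ?KB //.
    by rewrite eK mem_slope_field.
  (* Subtracting the value at 0 removes g(b), since g(0) = 0. *)
  move=> a aK; have := KB (gab a aK) (gab 0 (mxfield0 dimL prime_n fK)).
  by rewrite g0 -mulrBl opprB addrA subrK subr0.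
have {}nR b c : b \in K -> c \in K -> c != b ->
    slope_field b (slope c b) != slope_field c (slope c b).
  move=> bK cK cb; apply: contraNN nR => eR.
  by apply/existsP; exists b; apply/existsP; exists c; rewrite bK cK cb.
have K0 := mxfield0 dimL prime_n fK.
have K1 := mxfield1 dimL prime_n fK.
have gadd a b : a \in K -> b \in K -> g (a + b) = g a + g b.
  apply: (line_pres_additive t0 t1).
  - exact: (mxfieldD dimL prime_n fK).
  - exact: (mxfieldZ dimL prime_n fK).
  - move=> {}a {}b aK bK gab; apply/eqP; apply: contraT => ab.
    by have := gunit aK bK ab; rewrite gab subrr unitr0.
  - exact: g0.
  - move=> {}b c bK cK u; have [-> | cb] := eqVneq c b.
      by exists 0; rewrite subrr scaler0 scale0r !addr0.
    by apply: slope_fields_distinct_line => //; apply: nR.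
  move=> {}a aK; have [-> | a0] := eqVneq a 0.
    by exists 1 => // u; rewrite scaler0 oner_neq0.
  have [x xK nsx] := mxfield_nonscalar prime_n fK.
  exists (x * a); first exact: (mxfieldM dimL prime_n fK).
  move=> u; apply: contra nsx; rewrite -[u *: a]mul_scalar_mx => /eqP xa.
  apply/is_scalar_mxP; exists u.
  exact: (mulIr (unitK aK a0)) xa.
(* For additive g, the slope of a - b at 0 is the slope of a at b, so translation by 1 identifies
   the slopes at 0 with those at 1, against [nR]. *)
have := nR 0 1 K0 K1 (oner_neq0 _); case/eqP.
suff eS : slopes 0 = slopes 1 by rewrite /slope_field eS.
have gB a b : a \in K -> b \in K -> g (a - b) = g a - g b.
  by move=> aK bK; apply: (canRL (addrK _)); rewrite -gadd ?KB // subrK.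
have sB a b : a \in K -> b \in K -> slope (a - b) 0 = slope a b.
  by move=> aK bK; rewrite /slope g0 !subr0 gB.
apply/setP=> A; apply/imsetP/imsetP=> -[a aK ->].
  have aK1 := mxfieldD dimL prime_n fK aK K1.
  by exists (a + 1) => //; rewrite -(sB (a + 1) 1) // addrK.
by exists (a - 1); rewrite ?sB ?KB.
Qed.

End SlopeFields.

(** * Counting in pseudo-ovals *)

Lemma even_card_involution (T : finType) (f : T -> T) :
  involutive f -> (forall x, f x != x) -> ~~ odd #|T|.
Proof.
move=> fK fx; pose A := [set x | enum_rank x < enum_rank (f x)]%N.
have fA : f @: A = ~: A.
  apply/setP=> x; rewrite !inE -leqNgt; apply/imsetP/idP => [[y yA ->]|xA].
    by move: yA; rewrite inE fK => /ltnW.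
  exists (f x); rewrite ?inE ?fK // ltn_neqAle xA andbT.
  by rewrite (inj_eq val_inj) (inj_eq enum_rank_inj) fx.
by rewrite -(cardsC A) -fA card_imset ?addnn ?odd_double //; apply: inv_inj.
Qed.

Section PseudoOvalGeometry.

Variables (F : finFieldType) (n : nat).
Local Notation V := 'rV[F]_(3 * n).
Local Notation q := #|F|.
Local Notation I := 'I_(q ^ n).+1.
Variables (pi tau : I -> {vspace V}).
Hypotheses (n_gt0 : (0 < n)%N) (oval_pi : pseudo_oval pi).
Hypothesis tan_tau : forall i, tangent_space pi i (tau i).

Let dim_pi i : \dim (pi i) = n.
Proof. by case: oval_pi. Qed.

Lemma dim_ambient : \dim {:V} = (3 * n)%N.
Proof. by rewrite dimvf dim_matrix mul1r. Qed.

Lemma card_sub (U : {vspace V}) : #|[set v | v \in U]| = (q ^ \dim U)%N.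
Proof. by rewrite -card_vspace; apply: eq_card => v; rewrite !inE. Qed.

Lemma qn_gt1 : (1 < q ^ n)%N.
Proof.
by rewrite -(exp1n n) ltn_exp2r // finNzRing_gt1.
Qed.

Lemma third_index (i j : I) : exists2 k, k != i & k != j.
Proof.
have : (0 < #|~: [set i; j]|)%N.
  by rewrite cardsCs setCK card_ord cards2; case: eqP; have := qn_gt1; lia.
by case/card_gt0P=> k; rewrite !inE negb_or => /andP[]; exists k.
Qed.

Lemma dim_pi_pi i j : i != j -> \dim (pi i + pi j) = (2 * n)%N.
Proof.
move=> ij; have [k ki kj] := third_index i j.
have [_ _ span3] := oval_pi.
have := span3 i j k; rewrite /= !inE negb_or ij /= (eq_sym i k) ki eq_sym kj.
move=> /(_ isT) e.
have := dimv_sum_cap (pi i + pi j) (pi k); rewrite e dim_ambient dim_pi.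
have := dimv_sum_cap (pi i) (pi j); rewrite !dim_pi; lia.
Qed.

Lemma cap_pi_pi i j : i != j -> (pi i :&: pi j = 0)%VS.
Proof.
move=> ij; apply/eqP; rewrite -dimv_eq0.
by have := dimv_sum_cap (pi i) (pi j); rewrite dim_pi_pi // !dim_pi; lia.
Qed.

(** The span of pi_i and the j-th member of Delta_i, which does not depend on the complement
    chosen. *)
Definition sec i j := if j == i then tau i else (pi i + pi j)%VS.

Lemma dim_sec i j : \dim (sec i j) = (2 * n)%N.
Proof.
rewrite /sec; case: eqP => [_|/eqP ji]; first by case: (tan_tau i).
by rewrite dim_pi_pi // eq_sym.
Qed.

Lemma pi_sub_sec i j : (pi i <= sec i j)%VS.
Proof. by rewrite /sec; case: eqP; [case: (tan_tau i) | rewrite addvSl]. Qed.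

Lemma tau_pi_full i j : j != i -> (tau i + pi j = fullv)%VS.
Proof.
move=> ji; have [_ dt dj] := tan_tau i.
apply/eqP; rewrite eqEdim subvf dim_ambient dimv_disjoint_sum.
  by rewrite dt dim_pi; lia.
exact: dj.
Qed.

Lemma sec_add_full i j k : j != k -> (sec i j + sec i k = fullv)%VS.
Proof.
wlog ji : j k / j != i => [hw|].
  have [-> | ji] := eqVneq j i; last exact: hw.
  by rewrite eq_sym addvC => ki; apply: hw.
move=> jk; apply/eqP; rewrite eqEsubv subvf /=.
rewrite /sec (negPf ji); have [_ | ki] := eqVneq k i.
  by rewrite -(tau_pi_full ji) addvC addvS ?addvSr.
have [_ _ span3] := oval_pi.
rewrite -(span3 i j k); last by rewrite /= !inE negb_or jk ![i == _]eq_sym ji ki.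
by rewrite addvS ?addvSr.
Qed.

Lemma sec_cap i j k : j != k -> (sec i j :&: sec i k = pi i)%VS.
Proof.
move=> jk; apply/esym/eqP; rewrite eqEdim subv_cap !pi_sub_sec /=.
have := dimv_sum_cap (sec i j) (sec i k).
by rewrite sec_add_full // dim_ambient !dim_sec dim_pi; lia.
Qed.

(** Off pi_i the q^n + 1 spaces [sec i j] are disjoint. With x = q^n they contain (x + 1)(x^2 - x) =
    x^3 - x vectors there, which is all of them. *)
Lemma sec_cover i v : exists j, v \in sec i j.
Proof.
have [vi | vi] := boolP (v \in pi i).
  by exists i; apply: subvP (pi_sub_sec i i) _ vi.
pose Z j := [set u | u \in sec i j] :\: [set u | u \in pi i].
have cZ j : #|Z j| = (q ^ (2 * n) - q ^ n)%N.
  rewrite cardsD card_sub dim_sec.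
  have <- : #|[set u | u \in pi i]| = (q ^ n)%N by rewrite card_sub dim_pi.
  congr (_ - _)%N; apply: eq_card => u; rewrite !inE andbC.
  case: (boolP (u \in pi i)) => //= ui.
  exact: subvP (pi_sub_sec i j) _ ui.
have dZ j k : j != k -> [disjoint Z j & Z k].
  move=> jk; apply/pred0P=> u /=; apply/negP; rewrite !inE.
  case/andP=> /andP[/negP ui uj] /andP[_ uk]; apply: ui.
  by rewrite -(sec_cap i jk) memv_cap uj uk.
have : #|\bigcup_j Z j| = #|~: [set u | u \in pi i]|.
  rewrite -sum1_card partition_disjoint_bigcup //.
  under eq_bigr do rewrite sum1_card cZ.
  rewrite sum_nat_const card_ord cardsCs setCK card_sub dim_pi card_mx mul1n.
  have -> : (q ^ (2 * n) = q ^ n * q ^ n)%N by rewrite mul2n -addnn expnD.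
  have -> : (q ^ (3 * n) = q ^ n * q ^ n * q ^ n)%N.
    by rewrite -!expnD; congr (_ ^ _)%N; lia.
  by set x := (q ^ n)%N; rewrite mulnBr !mulSn; nia.
move=> ecard.
have /setP/(_ v) : \bigcup_j Z j = ~: [set u | u \in pi i].
  apply/eqP; rewrite eqEcard ecard leqnn andbT; apply/bigcupsP=> j _.
  by rewrite /Z setDE subsetIr.
by rewrite !inE vi => /bigcupP[j _]; rewrite !inE => /andP[_]; exists j.
Qed.

Lemma sec_inj_mem i j k v : v \notin pi i -> v \in sec i j -> v \in sec i k ->
  j = k.
Proof.
move=> vi vj vk; apply/eqP; apply: contraT => jk.
by rewrite -(sec_cap i jk) memv_cap vj vk in vi.
Qed.

(** If v lay in no tangent space, sending i to the j with v in <pi_i, pi_j> would be an involution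
    without fixed points on the q^n + 1 indices, whose number is odd. *)
Lemma tau_cover v : ~~ odd q -> exists i, v \in tau i.
Proof.
move=> oddq; apply/existsP; apply: contraT; rewrite negb_exists => /forallP vt.
have vp i : v \notin pi i.
  by apply: contra (vt i); apply: subvP; case: (tan_tau i).
have ex i : exists j, v \in sec i j by apply: sec_cover.
pose f i := xchoose (ex i).
have fP i : v \in sec i (f i) := xchooseP (ex i).
have fi i : f i != i.
  by apply: contraTneq (fP i); rewrite /sec => ->; rewrite eqxx vt.
have fK : involutive f.
  move=> i; apply/esym/(@sec_inj_mem (f i) _ _ v) => //.
  by have := fP i; rewrite /sec (negPf (fi i)) eq_sym (negPf (fi i)) addvC.
have := even_card_involution fK fi.
by rewrite card_ord /= oddX (negPf oddq) orbF; case: (n) n_gt0.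
Qed.

Lemma tau_cap i j : i != j -> \dim (tau i :&: tau j) = n.
Proof.
move=> ij; have [pj dj _] := tan_tau j; have [_ di _] := tan_tau i.
have e : (tau i + tau j = fullv)%VS.
  apply/eqP; rewrite eqEsubv subvf -(@tau_pi_full i j) ?addvS //.
  by rewrite eq_sym.
by have := dimv_sum_cap (tau i) (tau j); rewrite e dim_ambient di dj; lia.
Qed.

(** The other q^n tangent spaces cover all vectors outside tau_k. Counted with multiplicity they
    have q^n (q^(2n) - q^n) = q^(3n) - q^(2n) vectors there, just as many as are to be covered, so
    no vector outside tau_k lies in two of them. *)
Lemma nucleus i j k : ~~ odd q -> i != j -> (tau i :&: tau j <= tau k)%VS.
Proof.
move=> oddq ij; apply/subvP=> v; rewrite memv_cap => /andP[vi vj].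
apply: contraT => vk.
pose Y l : {set V} := [set u | u \in tau l] :\: [set u | u \in tau k].
have cY l : l != k -> #|Y l| = (q ^ (2 * n) - q ^ n)%N.
  move=> lk; rewrite cardsD card_sub; have [_ -> _] := tan_tau l.
  have <- : #|[set u | u \in (tau l :&: tau k)%VS]| = (q ^ n)%N.
    by rewrite card_sub tau_cap.
  by congr (_ - _)%N; apply: eq_card => u; rewrite !inE memv_cap.
have Yk : Y k = set0 by rewrite /Y setDv.
pose D : {set V} := ~: [set u | u \in tau k].
have cnt u : u \in D -> (1 <= \sum_l (u \in Y l))%N.
  rewrite inE inE => uk; have [l ul] := tau_cover u oddq.
  by rewrite (bigD1 l) //= !inE uk ul.
have tot : (\sum_(u in D) \sum_l (u \in Y l) = \sum_(u in D) 1)%N.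
  rewrite exchange_big /= (bigD1 k) //= Yk big1 => [|u _]; last by rewrite inE.
  have sY l : l != k ->
      (\sum_(u in D) (u \in Y l) = q ^ (2 * n) - q ^ n)%N.
    move=> lk; rewrite -(cY l lk) -sum1_card big_mkcond [RHS]big_mkcond /=.
    by apply: eq_bigr => u _; rewrite !inE; do 2!case: (u \in _).
  rewrite (eq_bigr _ sY) sum_nat_const cardC1 card_ord /= add0n sum1_card.
  rewrite cardsCs setCK card_sub card_mx mul1n; have [_ -> _] := tan_tau k.
  have -> : (q ^ (2 * n) = q ^ n * q ^ n)%N by rewrite mul2n -addnn expnD.
  have -> : (q ^ (3 * n) = q ^ n * q ^ n * q ^ n)%N.
    by rewrite -!expnD; congr (_ ^ _)%N; lia.
  by rewrite mulnBr !mulnA.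
have := leqif_sum (fun u uD => leqif_eq (cnt u uD)); rewrite -tot => -[_].
rewrite eqxx => /esym/forallP/(_ v)/implyP; rewrite !inE => /(_ vk).
rewrite (bigD1 i) //= (bigD1 j) /=; last by rewrite eq_sym.
by rewrite !inE vk vi vj.
Qed.

Lemma Delta_sec i W :
  Delta pi tau i W = [seq (sec i j :&: W)%VS | j : I].
Proof. by apply: eq_map => j; rewrite /sec; case: eqP. Qed.

Section Complement.

Variables (i : I) (W : {vspace V}).
Hypotheses (dimW : \dim W = (2 * n)%N) (capW : disjoint_spaces W (pi i)).

Lemma pi_W_full : (pi i + W = fullv)%VS.
Proof.
apply/eqP; rewrite eqEdim subvf dim_ambient addvC dimv_disjoint_sum //.
by rewrite dim_pi dimW; lia.
Qed.

Lemma capWK (Z : {vspace V}) : (pi i <= Z)%VS -> (pi i + Z :&: W = Z)%VS.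
Proof. by move=> pZ; rewrite capvC vspace_modl // pi_W_full capfv. Qed.

Lemma dim_capW (Z : {vspace V}) : (pi i <= Z)%VS ->
  (n + \dim (Z :&: W) = \dim Z)%N.
Proof.
move=> pZ; rewrite -{2}(capWK pZ) dimv_disjoint_sum ?dim_pi //.
apply/eqP; rewrite -subv0; apply: subv_trans (_ : pi i :&: W <= _)%VS.
  by rewrite capvS ?capvSr.
by rewrite capvC capW.
Qed.

Lemma spread_Delta : spread n W (Delta pi tau i W).
Proof.
rewrite Delta_sec; split.
- move=> _ /mapP[j _ ->]; split; first exact: capvSr.
  by have := dim_capW (pi_sub_sec i j); rewrite dim_sec; lia.
- move=> _ _ /mapP[j _ ->] /mapP[k _ ->] jk.
  have {}jk : j != k by apply: contraNneq jk => ->.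
  apply/eqP; rewrite -subv0 -capW; apply/subvP=> v; rewrite !memv_cap.
  case/andP=> /andP[vj ->] /andP[vk _].
  by rewrite -(sec_cap i jk) memv_cap vj.
move=> v vW; have [j vj] := sec_cover i v; exists (sec i j :&: W)%VS.
  by apply/mapP; exists j; rewrite ?mem_enum.
by rewrite memv_cap vj.
Qed.

End Complement.

End PseudoOvalGeometry.

(** * Reguli from an extension field structure *)

Lemma cramer2 (R : comRingType) (X Y c s1 t1 s2 t2 s3 t3 : R) :
  X * s1 + Y * s2 - c * s3 = 0 -> X * t1 + Y * t2 - c * t3 = 0 ->
  X * (s1 * t2 - s2 * t1) = c * (s3 * t2 - s2 * t3) /\
  Y * (s1 * t2 - s2 * t1) = c * (s1 * t3 - s3 * t1).
Proof.
move=> E1 E2; split; apply/eqP; rewrite -subr_eq0; apply/eqP.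
  transitivity (t2 * (X * s1 + Y * s2 - c * s3) -
    s2 * (X * t1 + Y * t2 - c * t3)); first by ring.
  by rewrite E1 E2 !mulr0 subrr.
transitivity (s1 * (X * t1 + Y * t2 - c * t3) -
  t1 * (X * s1 + Y * s2 - c * s3)); first by ring.
by rewrite E1 E2 !mulr0 subrr.
Qed.

Section ModuleStructure.

Variables (F : finFieldType) (L : fieldExtType F) (n : nat).
Local Notation V := 'rV[F]_(3 * n).
Local Notation q := #|F|.
Local Notation I := 'I_(q ^ n).+1.
Local Notation iota := (in_alg L).
Variables (pi tau : I -> {vspace V}).
Hypotheses (n_gt0 : (0 < n)%N) (oval_pi : pseudo_oval pi).
Hypothesis tan_tau : forall i, tangent_space pi i (tau i).
Hypothesis dimL : \dim {:L} = n.

Variables (act : L -> V -> V) (e : I -> V).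
Hypothesis actDl : forall c d v, act (c + d) v = act c v + act d v.
Hypothesis actDr : forall c u v, act c (u + v) = act c u + act c v.
Hypothesis actM : forall c d v, act (c * d) v = act c (act d v).
Hypothesis actF : forall (k : F) v, act (iota k) v = k *: v.
Hypothesis pi_act : forall i v, v \in pi i <-> exists c, v = act c (e i).

Local Notation sc := (sec pi tau).

Lemma act1 v : act 1 v = v.
Proof. by rewrite -(rmorph1 iota) actF scale1r. Qed.

Lemma act0 v : act 0 v = 0.
Proof. by rewrite -(rmorph0 iota) actF scale0r. Qed.

Lemma actZ c (k : F) v : act c (k *: v) = k *: act c v.
Proof. by rewrite -!actF -!actM mulrC. Qed.

Lemma actZl c (k : F) v : act (k *: c) v = k *: act c v.
Proof. by rewrite -actF -actM /= -scalerAl mul1r. Qed.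

Lemma actKV c v : c != 0 -> act c^-1 (act c v) = v.
Proof. by move=> c0; rewrite -actM mulVf // act1. Qed.

Lemma act_pi i c v : v \in pi i -> act c v \in pi i.
Proof. by move=> /pi_act[d ->]; apply/pi_act; exists (c * d); rewrite actM. Qed.

Lemma act_pi_inv i c v : c != 0 -> act c v \in pi i -> v \in pi i.
Proof. by move=> c0 cv; rewrite -(actKV v c0) act_pi. Qed.

Let act_sec_neq i j c v : j != i -> v \in sc i j -> act c v \in sc i j.
Proof.
rewrite /sec => /negPf ->.
case/memv_addP=> u ui [w wj ->]; rewrite actDr.
by rewrite memv_add ?act_pi.
Qed.

(** Only the tangent space is in question. If [c] moved a vector of tau_i outside pi_i into some
    <pi_i, pi_k>, then c^-1 would show the vector itself to be in <pi_i, pi_k>, which meets tau_i in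
    pi_i only. *)
Lemma act_sec i j c v : v \in sc i j -> act c v \in sc i j.
Proof.
have [-> | ji] := eqVneq j i; last exact: act_sec_neq.
move=> vi; have [-> | c0] := eqVneq c 0; first by rewrite act0 mem0v.
have [vp | vp] := boolP (v \in pi i).
  by apply: subvP (act_pi c vp); apply: pi_sub_sec.
have [k cvj] := sec_cover n_gt0 oval_pi tan_tau i (act c v).
have [eki | ki] := eqVneq k i; first by rewrite eki in cvj.
have : v \in sc i k by rewrite -(actKV v c0) act_sec_neq.
by move/(sec_inj_mem n_gt0 oval_pi tan_tau vp vi) => ik; rewrite -ik eqxx in ki.
Qed.

Lemma act_sec_inv i j c v : c != 0 -> act c v \in sc i j -> v \in sc i j.
Proof. by move=> c0 cv; rewrite -(actKV v c0) act_sec. Qed.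

(** [sec i j] is the direct sum of pi_i and the [L]-line of [a], both of F-dimension n. *)
Lemma sec_gen i j a v : a \in sc i j -> a \notin pi i -> v \in sc i j ->
  exists2 c, v - act c a \in pi i & (v \notin pi i -> c != 0).
Proof.
move=> aj ai vj.
have lin : linear (act^~ a) by move=> k c d; rewrite actDl actZl.
pose f : {linear L -> V} := HB.pack (act^~ a) (GRing.isLinear.Build _ _ _ _ _ lin).
have ker0 : lker (linfun f) = 0%VS.
  apply/eqP; rewrite -subv0; apply/subvP=> c; rewrite memv_ker lfunE /= memv0.
  apply: contraTT => c0; apply: contra ai => /eqP ca.
  by rewrite -(actKV a c0) ca -[0 : V](act0 0) act_pi // act0 mem0v.
have dimLa : \dim (limg (linfun f)) = n by rewrite limg_dim_eq ?ker0 ?capv0 ?dimL.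
have sLa : (limg (linfun f) <= sc i j)%VS.
  by apply/subvP=> _ /memv_imgP[c _ ->]; rewrite lfunE /= act_sec.
have capLa : (limg (linfun f) :&: pi i = 0)%VS.
  apply/eqP; rewrite -subv0; apply/subvP=> u; rewrite memv_cap memv0.
  case/andP=> /memv_imgP[c _ ->]; rewrite lfunE /=.
  have [-> | c0] := eqVneq c 0; first by rewrite act0.
  by move/(act_pi_inv c0); rewrite (negPf ai).
have /eqP eLa : (limg (linfun f) + pi i == sc i j)%VS.
  rewrite eqEdim subv_add sLa pi_sub_sec // dim_sec // dimv_disjoint_sum //.
  by rewrite dimLa; case: oval_pi => _ -> _; lia.
move: vj; rewrite -eLa => /memv_addP[_ /memv_imgP[c _ ->] [p pp ->]].
rewrite lfunE /=; exists c; first by rewrite addrAC subrr add0r.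
by apply: contraNneq => ->; rewrite act0 add0r.
Qed.

Section Reguli.

Variables (i j0 k0 : I) (a b : V) (W : {vspace V}).
Hypotheses (jk : j0 != k0) (aj : a \in sc i j0) (bk : b \in sc i k0).
Hypotheses (ai : a \notin pi i) (bi : b \notin pi i).
Hypotheses (dimW : \dim W = (2 * n)%N) (capW : disjoint_spaces W (pi i)).

Let pi_sec j v : v \in pi i -> v \in sc i j.
Proof. by apply: subvP; apply: pi_sub_sec. Qed.

Lemma act_ab_free x y : act x a + act y b \in pi i -> x = 0 /\ y = 0.
Proof.
move=> xy; split; apply/eqP; apply: contraT => nz; case/eqP: jk.
  apply: (sec_inj_mem n_gt0 oval_pi tan_tau ai aj).
  apply: (act_sec_inv nz); rewrite -[act x a](addrK (act y b)).
  by apply: memvB; [apply: pi_sec | apply: act_sec].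
apply/esym; apply: (sec_inj_mem n_gt0 oval_pi tan_tau bi bk).
apply: (act_sec_inv nz); rewrite -[act y b](addKr (act x a)) addrC.
by apply: memvB; [apply: pi_sec | apply: act_sec].
Qed.

Definition comb (s t : F) : V := s *: a + t *: b.

Lemma act_comb c s t : act c (comb s t) = act (c * iota s) a + act (c * iota t) b.
Proof. by rewrite actDr !actM !actF. Qed.

Lemma comb_notin s t : (s != 0) || (t != 0) -> comb s t \notin pi i.
Proof.
move=> st; apply/negP; rewrite -[comb s t]act1 act_comb !mul1r.
case/act_ab_free=> /eqP s0 /eqP t0.
by move: st; rewrite -(fmorph_eq0 iota s) -(fmorph_eq0 iota t) s0 t0.
Qed.

(** Homogeneous coordinates on the projective line over F, with [None] as the point at infinity. *)
Definition coords (o : option F) : F * F := if o is Some t then (1, t) else (0, 1).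

Definition pt o := comb (coords o).1 (coords o).2.

Lemma pt_notin o : pt o \notin pi i.
Proof. by case: o => [t|]; apply: comb_notin; rewrite oner_neq0 ?orbT. Qed.

Lemma coords_onto s t : (s != 0) || (t != 0) ->
  exists o, exists2 k : F, k != 0 & comb s t = k *: pt o.
Proof.
have [-> /= t0 | s0 _] := eqVneq s 0.
  by exists None, t => //; rewrite /pt /comb /= !scale0r !add0r scale1r.
exists (Some (t / s)), s => //.
by rewrite /pt /comb /= scalerDr !scalerA mulr1 mulrCA divff // mulr1.
Qed.

Definition ptidx o := xchoose (sec_cover n_gt0 oval_pi tan_tau i (pt o)).

Lemma ptidxP o : pt o \in sc i (ptidx o).
Proof. exact: (xchooseP (sec_cover n_gt0 oval_pi tan_tau i (pt o))). Qed.

Definition cdet (x y : F * F) : F := x.1 * y.2 - y.1 * x.2.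

Lemma cdet_neq0 o o' : o != o' -> cdet (coords o) (coords o') != 0.
Proof.
rewrite /cdet; apply: contra; case: o o' => [t|] [t'|] //=.
- by rewrite !mul1r subr_eq0 => /eqP ->.
- by rewrite mulr1 mul0r subr0 oner_eq0.
by rewrite mul0r mulr1 sub0r oppr_eq0 oner_eq0.
Qed.

Lemma ptidx_inj : injective ptidx.
Proof.
move=> o o' eqo; apply/eqP; apply: contraT => /cdet_neq0 d0.
have po := ptidxP o; have po' := ptidxP o'; rewrite -eqo in po'.
have aj' : a \in sc i (ptidx o).
  have : (coords o').2 *: pt o - (coords o).2 *: pt o' =
      cdet (coords o) (coords o') *: a.
    rewrite /pt /comb !scalerDr !scalerA opprD addrACA.
    rewrite [(coords o').2 * (coords o).2]mulrC subrr addr0 -scalerBl.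
    by rewrite ![_.2 * _.1]mulrC.
  move/(canLR (scalerK d0)) <-.
  by rewrite memvZ // memvB // memvZ.
have bj' : b \in sc i (ptidx o).
  have : (coords o).1 *: pt o' - (coords o').1 *: pt o =
      cdet (coords o) (coords o') *: b.
    rewrite /pt /comb !scalerDr !scalerA opprD addrACA.
    by rewrite [(coords o').1 * (coords o).1]mulrC subrr add0r -scalerBl.
  move/(canLR (scalerK d0)) <-.
  by rewrite memvZ // memvB // memvZ.
case/eqP: jk; transitivity (ptidx o).
  exact: (sec_inj_mem n_gt0 oval_pi tan_tau ai aj).
exact/esym/(sec_inj_mem n_gt0 oval_pi tan_tau bi bk).
Qed.

Definition reg : seq {vspace V} := [seq (sc i (ptidx o) :&: W)%VS | o : option F].

Lemma sec_capW_inj j k : (sc i j :&: W = sc i k :&: W)%VS -> j = k.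
Proof.
move=> jkW; apply/eqP; apply: contraT => njk.
have e1 : sc i j = sc i k.
  rewrite -(capWK n_gt0 oval_pi dimW capW (pi_sub_sec tan_tau i j)) jkW.
  exact: (capWK n_gt0 oval_pi dimW capW (pi_sub_sec tan_tau i k)).
have := sec_cap n_gt0 oval_pi tan_tau i njk; rewrite e1 capvv => e2.
have := dim_sec n_gt0 oval_pi tan_tau i k; rewrite e2.
by case: oval_pi => _ -> _; lia.
Qed.

Lemma regP A : reflect (exists o, A = (sc i (ptidx o) :&: W)%VS) (A \in reg).
Proof.
apply: (iffP mapP) => [[o _ ->] | [o ->]]; first by exists o.
by exists o; rewrite ?mem_enum.
Qed.

Lemma meets_vector (l A : {vspace V}) :
  meets l A -> exists2 v, v != 0 & (v \in l) && (v \in A).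
Proof.
rewrite /meets => lA; exists (vpick (l :&: A)); first by rewrite vpick0.
by rewrite -memv_cap memv_pick.
Qed.

Lemma capW0 v : v \in W -> v \in pi i -> v = 0.
Proof. by move=> vW vi; apply/eqP; rewrite -memv0 -capW memv_cap vW. Qed.

(** Modulo pi_i, such a line is c <a, b>_F for a single c in [L]. Its vectors in the three members
    are c1, c2, c3 times points of the subline; their F-linear relation, read in [L]-coordinates
    over [a] and [b], makes c1 and c2 F-multiples of c3. *)
Lemma transversal (l : {vspace V}) o1 o2 o3 : (l <= W)%VS -> \dim l = 2%N ->
    uniq [:: o1; o2; o3] ->
    (forall o, o \in [:: o1; o2; o3] -> meets l (sc i (ptidx o) :&: W)) ->
  exists c, [/\ c != 0,
    forall v, v \in l -> exists s t, v - act c (comb s t) \in pi i &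
    forall s t, exists2 v, v \in l & v - act c (comb s t) \in pi i].
Proof.
move=> lW dl; rewrite /= !inE negb_or andbT => /andP[/andP[o12 o13] o23] ml.
have pick o : o \in [:: o1; o2; o3] -> exists v c, [/\ v != 0, v \in l,
    v \in sc i (ptidx o), c != 0 & v - act c (pt o) \in pi i].
  move=> oo; have [v v0] := meets_vector (ml o oo).
  rewrite memv_cap => /and3P[vl vs vW].
  have [c vc c0] := sec_gen (ptidxP o) (pt_notin o) vs.
  exists v, c; split=> //; apply: c0; apply: contra v0 => vi.
  by rewrite (capW0 vW vi).
have [v1 [c1 [v10 v1l v1s c10 v1c]]] := pick o1 (mem_head _ _).
have [|v2 [c2 [v20 v2l v2s c20 v2c]]] := pick o2; first by rewrite !inE eqxx orbT.
have [|v3 [c3 [v30 v3l v3s c30 v3c]]] := pick o3.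
  by rewrite !inE eqxx !orbT.
have sec0 o o' v : o != o' -> v \in l -> v \in sc i (ptidx o) ->
    v \in sc i (ptidx o') -> v = 0.
  move=> oo vl vo vo'; apply: capW0 (subvP lW _ vl) _.
  have oo' : ptidx o != ptidx o' by rewrite (inj_eq ptidx_inj).
  by rewrite -(sec_cap n_gt0 oval_pi tan_tau i oo') memv_cap vo.
have lE v : v \in l -> exists x y : F, v = x *: v1 + y *: v2.
  have cap0 : (<[v1]> :&: <[v2]> = 0)%VS.
    apply/eqP; rewrite -subv0; apply/subvP=> u; rewrite memv_cap memv0.
    case/andP=> /vlineP[x ux] /vlineP[y uy]; apply/eqP.
    have ul : u \in l by rewrite ux memvZ.
    have u1 : u \in sc i (ptidx o1) by rewrite ux memvZ.
    have u2 : u \in sc i (ptidx o2) by rewrite uy memvZ.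
    exact: (sec0 o1 o2).
  have/eqP <- : (<[v1]> + <[v2]> == l)%VS.
    rewrite eqEdim subv_add -!memvE v1l v2l /= dl dimv_disjoint_sum //.
    by rewrite !dim_vline v10 v20.
  by case/memv_addP=> _ /vlineP[x ->] [_ /vlineP[y ->] ->]; exists x, y.
have [x [y v3E]] := lE _ v3l.
have x0 : x != 0.
  apply: contra v30 => /eqP x0; apply/eqP; apply: (sec0 o2 o3) => //.
  by rewrite v3E x0 scale0r add0r memvZ.
have y0 : y != 0.
  apply: contra v30 => /eqP y0; apply/eqP; apply: (sec0 o1 o3) => //.
  by rewrite v3E y0 scale0r addr0 memvZ.
have d0 := cdet_neq0 o12.
set s1 := (coords o1).1 in d0 *; set t1 := (coords o1).2 in d0 *.
set s2 := (coords o2).1 in d0 *; set t2 := (coords o2).2 in d0 *.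
pose s3 := (coords o3).1; pose t3 := (coords o3).2.
have pt1 : pt o1 = comb s1 t1 by [].
have pt2 : pt o2 = comb s2 t2 by [].
have pt3 : pt o3 = comb s3 t3 by [].
have [E1 E2] : iota x * c1 * iota s1 + iota y * c2 * iota s2 - c3 * iota s3 = 0
    /\ iota x * c1 * iota t1 + iota y * c2 * iota t2 - c3 * iota t3 = 0.
  apply: act_ab_free.
  have -> : act (iota x * c1 * iota s1 + iota y * c2 * iota s2 - c3 * iota s3) a
     + act (iota x * c1 * iota t1 + iota y * c2 * iota t2 - c3 * iota t3) b
     = x *: act c1 (pt o1) + y *: act c2 (pt o2) - act c3 (pt o3).
    rewrite pt1 pt2 pt3 !act_comb -!actF !actDr -!actM !mulrA.
    have actN c v : act (- c) v = - act c v.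
      by apply/eqP; rewrite -addr_eq0 -actDl addNr act0.
    rewrite !actDl !actN opprD addrACA; congr (_ + _).
    by rewrite addrACA.
  have -> : x *: act c1 (pt o1) + y *: act c2 (pt o2) - act c3 (pt o3) =
     (v3 - act c3 (pt o3)) - x *: (v1 - act c1 (pt o1))
       - y *: (v2 - act c2 (pt o2)).
    rewrite v3E !scalerBr !opprB -[RHS]addrA [_ - _ + (_ - _)]addrACA -opprD.
    by rewrite [RHS]addrC addrA subrK.
  apply: memvB; last exact: memvZ.
  by apply: memvB => //; apply: memvZ.
have nzF (k : F) : k != 0 -> iota k != 0 by rewrite fmorph_eq0.
have {}d0 : s1 * t2 - s2 * t1 != 0 := d0.
(* The ratios c1 / c3 and c2 / c3, as given by Cramer's rule; they lie in F. *)
pose r1 := (s3 * t2 - s2 * t3) / (x * (s1 * t2 - s2 * t1)).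
pose r2 := (s1 * t3 - s3 * t1) / (y * (s1 * t2 - s2 * t1)).
have [C1 C2] := cramer2 E1 E2.
have c1E : c1 = c3 * iota r1.
  apply: (mulfI (nzF _ x0)); apply: (mulIf (nzF _ d0)).
  have -> : iota x * (c3 * iota r1) * iota (s1 * t2 - s2 * t1) =
      c3 * iota (r1 * (x * (s1 * t2 - s2 * t1))) by rewrite !rmorphM /=; ring.
  by rewrite /r1 divfK ?mulf_neq0 // !rmorphB !rmorphM.
have c2E : c2 = c3 * iota r2.
  apply: (mulfI (nzF _ y0)); apply: (mulIf (nzF _ d0)).
  have -> : iota y * (c3 * iota r2) * iota (s1 * t2 - s2 * t1) =
      c3 * iota (r2 * (y * (s1 * t2 - s2 * t1))) by rewrite !rmorphM /=; ring.
  by rewrite /r2 divfK ?mulf_neq0 // !rmorphB !rmorphM.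
have r10 : r1 != 0 by apply: contra c10 => /eqP r10; rewrite c1E r10 rmorph0 mulr0.
have r20 : r2 != 0 by apply: contra c20 => /eqP r20; rewrite c2E r20 rmorph0 mulr0.
have combE z w : z *: v1 + w *: v2 -
    act c3 (comb (z * r1 * s1 + w * r2 * s2) (z * r1 * t1 + w * r2 * t2)) \in pi i.
  have -> : comb (z * r1 * s1 + w * r2 * s2) (z * r1 * t1 + w * r2 * t2) =
      (z * r1) *: pt o1 + (w * r2) *: pt o2.
    by rewrite pt1 pt2 /comb !scalerDr !scalerDl !scalerA addrACA.
  have -> : act c3 ((z * r1) *: pt o1 + (w * r2) *: pt o2) =
      z *: act c1 (pt o1) + w *: act c2 (pt o2).
    by rewrite actDr c1E c2E !actM !actF !actZ !scalerA.
  by rewrite opprD addrACA -!scalerBr memvD // memvZ.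
exists c3; split=> // [v /lE[z [w ->]] | s t].
  by exists (z * r1 * s1 + w * r2 * s2), (z * r1 * t1 + w * r2 * t2).
(* The coordinates of (s, t) in the basis (s1, t1), (s2, t2), corrected by [r1] and [r2]. *)
pose z := (s * t2 - s2 * t) / (s1 * t2 - s2 * t1) / r1.
pose w := (s1 * t - s * t1) / (s1 * t2 - s2 * t1) / r2.
exists (z *: v1 + w *: v2); first by rewrite memvD // memvZ.
have := combE z w; rewrite /z /w !divfK //.
have -> : (s * t2 - s2 * t) / (s1 * t2 - s2 * t1) * s1 +
    (s1 * t - s * t1) / (s1 * t2 - s2 * t1) * s2 = s by field.
have -> : (s * t2 - s2 * t) / (s1 * t2 - s2 * t1) * t1 +
    (s1 * t - s * t1) / (s1 * t2 - s2 * t1) * t2 = t by field.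
by [].
Qed.

Lemma regulus_reg : regulus n W reg.
Proof.
have reg_sec o : (pi i <= sc i (ptidx o))%VS by apply: pi_sub_sec.
have neq_sec o o' : (sc i (ptidx o) :&: W)%VS != (sc i (ptidx o') :&: W)%VS ->
    o != o' by apply: contra => /eqP ->.
split.
- split; last by rewrite size_map -cardE card_option.
  rewrite map_inj_uniq ?enum_uniq // => o o' /sec_capW_inj.
  exact: ptidx_inj.
- move=> _ /regP[o ->]; split; first exact: capvSr.
  have := dim_capW n_gt0 oval_pi dimW capW (reg_sec o).
  by rewrite dim_sec //; lia.
- move=> _ _ /regP[o ->] /regP[o' ->] /neq_sec oo.
  have oo' : ptidx o != ptidx o' by rewrite (inj_eq ptidx_inj).
  apply/eqP; rewrite -subv0 -capW; apply/subvP=> v; rewrite !memv_cap.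
  case/andP=> /andP[vj ->] /andP[vk _].
  by rewrite -(sec_cap n_gt0 oval_pi tan_tau i oo') memv_cap vj.
move=> l _ _ _ lW dl /regP[o1 ->] /regP[o2 ->] /regP[o3 ->] /=.
rewrite !inE negb_or andbT => /andP[/andP[/neq_sec o12 /neq_sec o13] /neq_sec o23].
move=> m1 m2 m3.
have [|o|c [c0 lc1 lc2]] := transversal lW dl (o1 := o1) (o2 := o2) (o3 := o3).
- by rewrite /= !inE negb_or o12 o13 o23.
- by rewrite !inE => /or3P[] /eqP ->.
split=> [_ /regP[o ->] | v vl].
  have [v vl vc] := lc2 (coords o).1 (coords o).2; rewrite -/(pt o) in vc.
  have v0 : v != 0.
    apply: contra (pt_notin o) => /eqP v0; apply: (act_pi_inv c0).
    by move: vc; rewrite v0 sub0r memvN.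
  apply: contraNneq v0 => lo; rewrite -memv0 -lo !memv_cap vl (subvP lW) // andbT.
  rewrite -[v](subrK (act c (pt o))); apply: memvD; first exact: pi_sec.
  by apply: act_sec; apply: ptidxP.
have [s [t vst]] := lc1 v vl.
have [st | st] := boolP ((s != 0) || (t != 0)); last first.
  (* For s = t = 0 the vector is 0 and any member of the regulus serves. *)
  have DN : (sc i (ptidx (@None F)) :&: W)%VS \in reg by apply/regP; exists None.
  exists (sc i (ptidx (@None F)) :&: W)%VS => //.
  suff v0 : v = 0 by rewrite v0 mem0v.
  apply: capW0 (subvP lW _ vl) _; move: st; rewrite negb_or !negbK.
  case/andP=> /eqP s0 /eqP t0; move: vst.
  rewrite /comb s0 t0 !scale0r addr0 -{1}[0](scale0r (0 : V)) actZ scale0r subr0.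
  by [].
have [o [k _ e0]] := coords_onto st.
exists (sc i (ptidx o) :&: W)%VS; first by apply/regP; exists o.
rewrite memv_cap (subvP lW) // andbT -[v](subrK (act c (comb s t))).
apply: memvD; first exact: pi_sec.
by rewrite e0 actZ memvZ //; apply: act_sec; apply: ptidxP.
Qed.

End Reguli.

Lemma regular_spread_of_module i W : \dim W = (2 * n)%N ->
  disjoint_spaces W (pi i) -> regular_spread n W (Delta pi tau i W).
Proof.
move=> dimW capW; split; first exact: spread_Delta.
rewrite Delta_sec // => A B C /mapP[j _ ->] /mapP[k _ ->] /mapP[l _ ->].
rewrite /= !inE negb_or andbT => /andP[/andP[jk jl] kl].
have {}jk : j != k by apply: contra jk => /eqP ->.
have {}jl : j != l by apply: contra jl => /eqP ->.
have {}kl : k != l by apply: contra kl => /eqP ->.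
have [c cl ci] : exists2 c, c \in sc i l & c \notin pi i.
  have : ~~ (sc i l <= pi i)%VS.
    apply/negP => /dimvS; rewrite dim_sec //.
    by case: oval_pi => _ -> _; lia.
  by case/subvPn=> c; exists c.
(* Splitting a vector of the third member as a + b makes the three members the points 0, infinity
   and 1 of the subline. *)
have : c \in (sc i j + sc i k)%VS by rewrite sec_add_full // memvf.
case/memv_addP=> a aj [b bk cab].
have ai : a \notin pi i.
  apply: contra ci => ai; rewrite -(sec_cap n_gt0 oval_pi tan_tau i kl).
  rewrite memv_cap cl andbT cab memvD //.
  by apply: subvP ai; apply: pi_sub_sec.
have bi : b \notin pi i.
  apply: contra ci => bi; rewrite -(sec_cap n_gt0 oval_pi tan_tau i jl).
  rewrite memv_cap cl andbT cab memvD //.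
  by apply: subvP bi; apply: pi_sub_sec.
have idxE o h : pt a b o \in sc i h -> ptidx i a b o = h.
  exact: (sec_inj_mem n_gt0 oval_pi tan_tau (pt_notin jk aj bk ai bi o)
    (ptidxP i a b o)).
exists (reg i a b W); split.
- exact: (regulus_reg jk).
- move=> X; rewrite !inE => /or3P[] /eqP ->; apply/regP.
  + exists (Some 0); rewrite (@idxE _ j) //.
    by rewrite /pt /comb /= scale1r scale0r addr0.
  + exists None; rewrite (@idxE _ k) //.
    by rewrite /pt /comb /= scale1r scale0r add0r.
  exists (Some 1); rewrite (@idxE _ l) //.
  by rewrite /pt /comb /= !scale1r -cab.
by move=> X /regP[o ->]; apply/mapP; exists (ptidx i a b o); rewrite ?mem_enum.
Qed.

End ModuleStructure.

(** * Galois descent *)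

Section GaloisDescent.

Variables (F : finFieldType) (L : splittingFieldType F) (n : nat).
Local Notation V := 'rV[F]_(3 * n).
Local Notation VL := 'rV[L]_(3 * n).
Local Notation iota := (in_alg L).
Local Notation G := ('Gal({:L} / 1)%g).
Hypothesis dimL : \dim {:L} = n.

Lemma galois1L : galois 1%AS {:L}%AS.
Proof. by apply: finField_galois; apply: sub1v. Qed.

Lemma card_gal : #|G| = n.
Proof. by rewrite -(galois_dim galois1L) dimv1 divn1 dimL. Qed.

Lemma gal_iota (s : gal_of {:L}) (k : F) : s (iota k) = iota k.
Proof. by rewrite rmorph_alg. Qed.

Lemma map_mx_gal_iota (s : gal_of {:L}) p r (M : 'M[F]_(p, r)) :
  map_mx s (map_mx iota M) = map_mx iota M.
Proof. by apply/matrixP=> i j; rewrite !mxE gal_iota. Qed.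

Lemma map_mx_galM (s r : gal_of {:L}) m p (M : 'M[L]_(m, p)) :
  map_mx (s * r)%g M = map_mx r (map_mx s M).
Proof. by apply/matrixP=> i j; rewrite !mxE galM ?memvf. Qed.

Lemma map_mx_gal1 m p (M : 'M[L]_(m, p)) : map_mx (1%g : gal_of {:L}) M = M.
Proof. by apply/matrixP=> i j; rewrite !mxE gal_id. Qed.

Lemma mem_conj_spaceE (s : gal_of {:L}) (U : {vspace VL}) v :
  (v \in conj_space s U) = (map_mx (s^-1)%g v \in U).
Proof. by rewrite -(mem_conj_space s U) -map_mx_galM mulVg map_mx_gal1. Qed.

Lemma dim_conj_space (s : gal_of {:L}) (U : {vspace VL}) :
  (\dim (conj_space s U) <= \dim U)%N.
Proof. by apply: leq_trans (dim_span _) _; rewrite size_map size_tuple. Qed.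

Lemma conj_spaceS (s : gal_of {:L}) (U U' : {vspace VL}) :
  (U <= U')%VS -> (conj_space s U <= conj_space s U')%VS.
Proof.
by move=> /subvP sUU; apply/subvP=> v; rewrite !mem_conj_spaceE; apply: sUU.
Qed.

Lemma dim_conj_span (U : {vspace VL}) : (\dim (conj_span U) <= n * \dim U)%N.
Proof.
apply: leq_trans (dimv_leq_sum _ _ _) _.
apply: (@leq_trans (\sum_(s in G) \dim U)).
  by apply: leq_sum => s _; apply: dim_conj_space.
by rewrite sum_nat_const card_gal.
Qed.

Definition trace (w : VL) : VL := \sum_(s in G) map_mx s w.

(** The default is never reached on the entries of a trace, which are rational. *)
Definition to_base (c : L) : F := odflt 0 [pick k | iota k == c].

Definition rtrace (w : VL) : V := map_mx to_base (trace w).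

Lemma rtraceE w : map_mx iota (rtrace w) = trace w.
Proof.
apply/rowP=> j; rewrite 2!mxE /to_base.
case: pickP => [k /eqP -> // | none].
have : trace w 0 j \in 1%VS.
  have <- : galTrace 1%AS {:L}%AS (w 0 j) = trace w 0 j.
    by rewrite /galTrace /trace summxE; apply: eq_bigr => s _; rewrite mxE.
  have := galTrace_fixedField 1%AS (memvf (w 0 j) : w 0 j \in {:L}%AS).
  by have /galois_fixedField -> := galois1L.
by case/vlineP=> k e; have := none k; rewrite e eqxx.
Qed.

Lemma map_iota_inj m p : injective (map_mx iota : 'M[F]_(m, p) -> 'M[L]_(m, p)).
Proof. exact: map_mx_inj. Qed.

Lemma traceD u w : trace (u + w) = trace u + trace w.
Proof. by rewrite /trace -big_split; apply: eq_bigr => s _; rewrite map_mxD. Qed.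

Lemma traceZ (k : F) w : trace (iota k *: w) = iota k *: trace w.
Proof.
rewrite /trace scaler_sumr; apply: eq_bigr => s _; rewrite map_mxZ.
by congr (_ *: _); apply: gal_iota.
Qed.

Lemma rtraceD u w : rtrace (u + w) = rtrace u + rtrace w.
Proof. by apply: map_iota_inj; rewrite map_mxD !rtraceE traceD. Qed.

Lemma rtraceZ (k : F) w : rtrace (iota k *: w) = k *: rtrace w.
Proof. by apply: map_iota_inj; rewrite map_mxZ !rtraceE traceZ. Qed.

Section Descent.

Variable xi : {vspace VL}.
Hypotheses (dim_xi : \dim xi = 3%N) (span_xi : conj_span xi = fullv).

(** There are n conjugates of dimension at most 3, and they span a space of dimension 3n. *)
Lemma conj_direct : directv (\sum_(s in G) conj_space s xi).
Proof.
rewrite directvE /= -[(\sum_(s in G) _)%VS]/(conj_span xi) span_xi.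
rewrite eqn_leq -{1}span_xi dimv_leq_sum dimvf dim_matrix mul1r.
apply: (@leq_trans (\sum_(s in G) \dim xi)).
  by apply: leq_sum => s _; apply: dim_conj_space.
by rewrite sum_nat_const card_gal dim_xi mulnC.
Qed.

Lemma trace_inj w : w \in xi -> trace w = 0 -> w = 0.
Proof.
move=> wxi tw.
have /directv_sum_independent/(_ (fun s => map_mx s w)) := conj_direct.
move=> /(_ _ tw 1%g (group1 _)); rewrite map_mx_gal1; apply.
by move=> s _; rewrite mem_conj_space.
Qed.

(** A Galois element fixes a rational vector and permutes the components of its decomposition. As
    the sum of the conjugates of [xi] is direct, every component is the conjugate of the one at the
    identity. *)
Lemma rational_trace (Y : {vspace VL}) v : (Y <= xi)%VS ->
  map_mx iota v \in conj_span Y -> exists2 w, w \in Y & rtrace w = v.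
Proof.
move=> sY /memv_sumP[us usY vE].
exists (us 1%g).
  by have := usY 1%g (group1 _); rewrite mem_conj_spaceE invg1 map_mx_gal1.
apply: map_iota_inj; rewrite rtraceE vE; apply: eq_bigr => r rG.
have e : \sum_(s in G) us s = \sum_(s in G) map_mx r (us (s * r^-1)%g).
  rewrite -vE -(map_mx_gal_iota r) vE map_mx_sum.
  rewrite (reindex_inj (mulIg (r^-1)%g)) /=; apply: eq_bigl => s.
  by rewrite groupMr ?groupV.
have usxi s : s \in G -> us s \in conj_space s xi.
  by move=> sG; apply: subvP (conj_spaceS s sY) _ (usY s sG).
have us'xi s : s \in G -> map_mx r (us (s * r^-1)%g) \in conj_space s xi.
  move=> sG; have := usxi (s * r^-1)%g; rewrite groupMr ?groupV // => /(_ sG).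
  by rewrite !mem_conj_spaceE -map_mx_galM invMg invgK.
have := directv_sum_unique conj_direct us
  (fun s => map_mx r (us (s * r^-1)%g)) usxi us'xi.
rewrite {1}e eqxx => /esym/forallP/(_ r); rewrite rG mulgV.
by move/eqP.
Qed.

Lemma trace_conj_span (Y : {vspace VL}) w : w \in Y ->
  map_mx iota (rtrace w) \in conj_span Y.
Proof.
by move=> wY; rewrite rtraceE; apply: memv_sumr => s _; rewrite mem_conj_space.
Qed.

End Descent.

(** The trace is an F-isomorphism from [xi] to V which maps the point x_i onto g(pi_i). The scalar
    multiplication of [L] on [xi] is transported along it, and [e i] comes from a generator of
    x_i. *)
Lemma regular_module k (pi : 'I_k -> {vspace V}) (x : 'I_k -> {vspace VL})
    (xi : {vspace VL}) (g : 'End(V)) :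
    lker g = 0%VS -> \dim xi = 3%N -> conj_span xi = fullv ->
    (forall i, (x i <= xi)%VS /\ \dim (x i) = 1%N) ->
    (forall i v, (v \in (g @: pi i)%VS) = (map_mx iota v \in conj_span (x i))) ->
  exists (act : L -> V -> V) (e : 'I_k -> V),
    [/\ forall c d v, act (c + d) v = act c v + act d v,
        forall c u v, act c (u + v) = act c u + act c v,
        forall c d v, act (c * d) v = act c (act d v),
        forall (k : F) v, act (iota k) v = k *: v
      & forall i v, v \in pi i <-> exists c, v = act c (e i)].
Proof.
move=> ker0 dim_xi span_xi x_xi piE.
have ex v : exists w, (w \in xi) && (rtrace w == v).
  have [||w wxi <-] := rational_trace dim_xi span_xi (Y := xi) (v := v).
  - exact: subvv.
  - by rewrite span_xi memvf.
  by exists w; rewrite wxi eqxx.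
pose P v := xchoose (ex v).
have Pxi v : P v \in xi by have /andP[] := xchooseP (ex v).
have PK v : rtrace (P v) = v by have /andP[_ /eqP] := xchooseP (ex v).
have rtr_inj u w : u \in xi -> w \in xi -> rtrace u = rtrace w -> u = w.
  move=> uxi wxi uw; apply: subr0_eq; apply: (trace_inj dim_xi span_xi).
    by rewrite memvB.
  rewrite -scaleN1r -(rmorphN1 iota) traceD traceZ -!rtraceE uw.
  by rewrite rmorphN1 scaleN1r subrr.
have TK w : w \in xi -> P (rtrace w) = w.
  by move=> wxi; apply: rtr_inj; rewrite ?PK.
have PD u v : P (u + v) = P u + P v.
  by apply: rtr_inj; rewrite ?memvD // rtraceD !PK.
have kg0 : lker g == 0%VS by rewrite ker0.
have gK := lker0_lfunK kg0.
have gVK v : g ((g^-1)%VF v) = v.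
  exact: lker0_lfunVK.
exists (fun c v => (g^-1)%VF (rtrace (c *: P (g v)))).
exists (fun i => (g^-1)%VF (rtrace (vpick (x i)))); split.
- by move=> c d v; rewrite scalerDl rtraceD linearD.
- by move=> c u v; rewrite linearD PD scalerDr rtraceD linearD.
- by move=> c d v; rewrite gVK TK ?scalerA // memvZ.
- by move=> l v; rewrite rtraceZ PK linearZ /= gK.
move=> i v; have [xi1 dim1] := x_xi i.
have yx : vpick (x i) \in x i by apply: memv_pick.
have yxi : vpick (x i) \in xi by apply: subvP xi1 _ yx.
have xE w : w \in x i -> exists c, w = c *: vpick (x i).
  have /eqP xl : (<[vpick (x i)]> == x i)%VS.
    rewrite eqEdim -memvE yx dim1 dim_vline vpick0.
    by rewrite -dimv_eq0 dim1.
  by rewrite -{1}xl => /vlineP.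
have giE : (v \in pi i) = (g v \in (g @: pi i)%VS).
  apply/idP/idP => [vi | /memv_imgP[u ui /(congr1 (g^-1)%VF)]].
    exact: memv_img.
  by rewrite !gK => ->.
rewrite giE piE gVK TK //; split.
  case/(rational_trace dim_xi span_xi xi1) => w /xE[c ->] gv.
  by exists c; rewrite gv gK.
by case=> c ->; rewrite gVK; apply: trace_conj_span; rewrite memvZ.
Qed.

End GaloisDescent.

(** * Spread sets *)

Section RowSpaces.

Variables (K : fieldType) (r : nat).

Definition rowspan p (M : 'M[K]_(p, r)) : {vspace 'rV[K]_r} :=
  limg (linfun (mulmxr M : 'rV[K]_p -> 'rV[K]_r)).

Lemma rowspanP p (M : 'M[K]_(p, r)) v :
  reflect (exists x : 'rV[K]_p, v = x *m M) (v \in rowspan M).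
Proof.
apply: (iffP memv_imgP) => [[x _ ->] | [x ->]]; exists x; rewrite ?memvf //.
  by rewrite lfunE.
by rewrite lfunE.
Qed.

Lemma mem_rowspan p (M : 'M[K]_(p, r)) x : x *m M \in rowspan M.
Proof. by apply/rowspanP; exists x. Qed.

Lemma rowspan_sub p (M : 'M[K]_(p, r)) (U : {vspace 'rV[K]_r}) :
  (forall x, x *m M \in U) -> (rowspan M <= U)%VS.
Proof. by move=> MU; apply/subvP=> _ /rowspanP[x ->]. Qed.

Lemma dim_rowspan p (M : 'M[K]_(p, r)) :
  (forall x : 'rV[K]_p, x *m M = 0 -> x = 0) -> \dim (rowspan M) = p.
Proof.
move=> M_inj; rewrite limg_dim_eq ?dimvf ?dim_matrix ?mul1r //.
apply/eqP; rewrite -subv0; apply/subvP=> x; rewrite memv_cap memv_ker lfunE.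
by rewrite memv0 => /andP[_ /eqP/M_inj ->].
Qed.

Lemma rowspan_unit p (X : 'M[K]_p) (M : 'M[K]_(p, r)) :
  X \in unitmx -> rowspan (X *m M) = rowspan M.
Proof.
move=> uX; apply/eqP; rewrite eqEsubv; apply/andP; split.
  by apply: rowspan_sub => x; rewrite mulmxA mem_rowspan.
apply: rowspan_sub => x; apply/rowspanP.
by exists (x *m invmx X); rewrite mulmxA mulmxKV.
Qed.

Lemma rowspan_basis p (U : {vspace 'rV[K]_r}) : \dim U = p ->
  exists2 M : 'M[K]_(p, r), U = rowspan M &
    forall x : 'rV[K]_p, x *m M = 0 -> x = 0.
Proof.
move=> <-; exists (\matrix_(i < \dim U) (vbasis U)`_i) => [|x].
  apply/vspaceP=> v; apply/idP/rowspanP => [vU | [x ->]].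
    exists (\row_i coord (vbasis U) i v).
    rewrite {1}(coord_vbasis vU) mulmx_sum_row; apply: eq_bigr => i _.
    by rewrite mxE rowK.
  rewrite mulmx_sum_row memv_suml // => i _.
  by rewrite rowK memvZ // vbasis_mem // mem_nth // size_tuple.
rewrite mulmx_sum_row => x0; apply/rowP=> i; rewrite mxE.
have /freeP/(_ (fun i => x 0 i)) := basis_free (vbasisP U); apply.
by rewrite -[RHS]x0; apply: eq_bigr => j _; rewrite rowK.
Qed.

End RowSpaces.

Section SpreadSets.

Variables (F : finFieldType) (m : nat).
Local Notation n := m.+1.
Local Notation V := 'rV[F]_(3 * n).
Local Notation q := #|F|.
Local Notation I := 'I_(q ^ n).+1.
Variables (pi tau : I -> {vspace V}).
Hypothesis oval_pi : pseudo_oval pi.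
Hypothesis tan_tau : forall i, tangent_space pi i (tau i).
Local Notation sc := (sec pi tau).

Let n_gt0 : (0 < n)%N := ltn0Sn m.

Variables (i : I) (W : {vspace V}).
Hypotheses (dimW : \dim W = (2 * n)%N) (capW : disjoint_spaces W (pi i)).
Hypothesis regW : regular_spread n W (Delta pi tau i W).

Let dim_pi j : \dim (pi j) = n.
Proof. by case: oval_pi. Qed.

(** Modulo pi_i, the k-th spread member is the graph of [M] over the frame [Q1], [Q2]: its vectors
    are the x Q1 + (x M) Q2. *)
Definition has_slope (Q1 Q2 : 'M[F]_(n, 3 * n)) k (M : 'M[F]_n) :=
  sc i k = (pi i + rowspan (Q1 + M *m Q2))%VS.

Lemma has_slope_swap Q1 Q2 k M : M \in unitmx ->
  has_slope Q1 Q2 k M -> has_slope Q2 Q1 k (invmx M).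
Proof.
rewrite /has_slope => uM ->; congr (_ + _)%VS.
by rewrite -(rowspan_unit (Q2 + _) uM) mulmxDr mulmxA mulmxV // mul1mx addrC.
Qed.

Lemma sec_inj j k : sc i j = sc i k -> j = k.
Proof.
move=> ejk; apply/eqP; apply: contraT => jk.
have := sec_cap n_gt0 oval_pi tan_tau i jk; rewrite ejk capvv => e.
by have := dim_sec n_gt0 oval_pi tan_tau i k; rewrite e dim_pi; clear; lia.
Qed.

Section Slopes.

Variables (Q1 Q2 : 'M[F]_(n, 3 * n)) (jinf : I).
Hypothesis Qfree : forall x y : 'rV[F]_n,
  x *m Q1 + y *m Q2 \in pi i -> x = 0 /\ y = 0.
Hypothesis Qinf : sc i jinf = (pi i + rowspan Q2)%VS.

Let memQ x y M : x *m Q1 + y *m Q2 \in (pi i + rowspan (Q1 + M *m Q2))%VS ->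
  y = x *m M.
Proof.
case/memv_addP=> p pp [_ /rowspanP[z ->] e].
have : (x - z) *m Q1 + (y - z *m M) *m Q2 \in pi i.
  suff -> : (x - z) *m Q1 + (y - z *m M) *m Q2 = p by [].
  rewrite !mulmxBl addrACA e mulmxDr -opprD mulmxA addrK //.
by case/Qfree => /subr0_eq -> /subr0_eq.
Qed.

Let memQinf x y : x *m Q1 + y *m Q2 \in sc i jinf -> x = 0.
Proof.
rewrite Qinf => /memv_addP[p pp [_ /rowspanP[z ->] e]].
have : x *m Q1 + (y - z) *m Q2 \in pi i.
  by rewrite mulmxBl addrA e addrK.
by case/Qfree.
Qed.

Lemma has_slope_uniq k M M' : has_slope Q1 Q2 k M -> has_slope Q1 Q2 k M' ->
  M = M'.
Proof.
move=> hM hM'; apply/row_matrixP=> j; rewrite !rowE; apply: memQ.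
rewrite -hM' hM -mulmxA -mulmxDr; apply: subvP (addvSr _ _) _ _.
exact: mem_rowspan.
Qed.

Lemma has_slope_neq_inf k M : has_slope Q1 Q2 k M -> k != jinf.
Proof.
move=> hM; apply/eqP=> ek.
have : delta_mx 0 0 *m Q1 + (delta_mx 0 0 *m M) *m Q2 \in sc i jinf.
  rewrite -ek hM -mulmxA -mulmxDr; apply: subvP (addvSr _ _) _ _.
  exact: mem_rowspan.
move/memQinf/rowP/(_ 0); rewrite !mxE !eqxx => /eqP.
by rewrite oner_eq0.
Qed.

Let proj v : exists2 w, w \in W & v - w \in pi i.
Proof.
have : v \in (pi i + W)%VS by rewrite (pi_W_full n_gt0 oval_pi dimW capW) memvf.
by case/memv_addP=> p pp [w wW ->]; exists w; rewrite ?addrK.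
Qed.

Let pi_sec k v : v \in pi i -> v \in sc i k.
Proof. by apply: subvP; apply: pi_sub_sec. Qed.

Let sec_proj k v w : v - w \in pi i -> v \in sc i k -> w \in sc i k.
Proof.
move=> vw vk; rewrite -[w](subKr v); apply: memvB => //; exact: pi_sec.
Qed.

(** The members with slopes [A], [B] and infinity determine a regulus inside Delta_i. For each
    nonzero x, the line through x (Q1 + A Q2) and x (B - A) Q2 is a transversal. The regulus member
    through the point with parameter [t] on one transversal meets all of them, and linearity forces
    the parameter [t] everywhere, so it is the graph of A + t (B - A). *)
Lemma has_slope_line j1 j2 A B (t : F) :
  has_slope Q1 Q2 j1 A -> has_slope Q1 Q2 j2 B ->
  exists k, has_slope Q1 Q2 k (A + t *: (B - A)).
Proof.
move=> hA hB; have [j12 | j12] := eqVneq j1 j2.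
  have -> : B = A by apply: has_slope_uniq hB _; rewrite -j12.
  by exists j1; rewrite subrr scaler0 addr0.
have n1 := has_slope_neq_inf hA; have n2 := has_slope_neq_inf hB.
have memA (x : 'rV_n) : x *m (Q1 + A *m Q2) \in sc i j1.
  by rewrite hA; apply: subvP (addvSr _ _) _ _; apply: mem_rowspan.
have memB (x : 'rV_n) : x *m (Q1 + B *m Q2) \in sc i j2.
  by rewrite hB; apply: subvP (addvSr _ _) _ _; apply: mem_rowspan.
have memI (x : 'rV_n) : x *m Q2 \in sc i jinf.
  by rewrite Qinf; apply: subvP (addvSr _ _) _ _; apply: mem_rowspan.
have BA_inj (x : 'rV_n) : x *m (B - A) = 0 -> x = 0.
  move=> /eqP; rewrite mulmxBr subr_eq0 => /eqP xBA.
  have := memA x; rewrite mulmxDr mulmxA -xBA -mulmxA -mulmxDr => xj1.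
  have : x *m (Q1 + B *m Q2) \in pi i.
    by rewrite -(sec_cap n_gt0 oval_pi tan_tau i j12) memv_cap xj1 memB.
  by rewrite mulmxDr mulmxA => /Qfree[].
pose u (x : 'rV_n) := x *m (Q1 + A *m Q2); pose w (x : 'rV_n) := x *m (B - A) *m Q2.
have uw_free x (c d : F) : x != 0 -> c *: u x + d *: w x \in pi i ->
    c = 0 /\ d = 0.
  move=> x0 cd.
  have : (c *: x) *m Q1 + (c *: x *m A + d *: (x *m (B - A))) *m Q2 \in pi i.
    rewrite mulmxDl addrA -!scalemxAl -scalerDr -mulmxA -mulmxDr; exact: cd.
  case/Qfree=> /eqP; rewrite scaler_eq0 (negPf x0) orbF => /eqP c0.
  rewrite c0 scale0r mul0mx add0r => /eqP; rewrite scaler_eq0 => /orP[/eqP //|].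
  by move/eqP/BA_inj/eqP; rewrite (negPf x0).
have [_ regul] := regW.
have mD k : (sc i k :&: W)%VS \in Delta pi tau i W.
  by rewrite Delta_sec //; apply/mapP; exists k; rewrite ?mem_enum.
have capW_neq j k : j != k -> (sc i j :&: W != sc i k :&: W)%VS.
  apply: contra => /eqP jk; apply/eqP/sec_inj.
  rewrite -(capWK n_gt0 oval_pi dimW capW (pi_sub_sec tan_tau i j)) jk.
  exact: (capWK n_gt0 oval_pi dimW capW (pi_sub_sec tan_tau i k)).
have [|R [[_ Rdim Rdisj Rline] sR RD]] := regul _ _ _ (mD j1) (mD j2) (mD jinf).
  by rewrite /= !inE negb_or !capW_neq.
(* The projections of [u x] and [w x] to [W] span a line which meets the three given members at the
   parameters (1, 0), (1, 1) and (0, 1). *)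
have line_x (x : 'rV_n) : x != 0 ->
    (forall D, D \in R -> exists c d : F, ((c != 0) || (d != 0)) /\
       exists2 v, v \in D & c *: u x + d *: w x - v \in pi i) /\
    (forall c d : F, exists2 D, D \in R & exists2 v, v \in D &
       c *: u x + d *: w x - v \in pi i).
  move=> x0.
  have [a aW ua] := proj (u x); have [b bW wb] := proj (w x).
  pose l := (<[a]> + <[b]>)%VS.
  have lW : (l <= W)%VS by rewrite subv_add -!memvE aW bW.
  have cdab c d : c *: u x + d *: w x - (c *: a + d *: b) \in pi i.
    by rewrite opprD addrACA -!scalerBr memvD // memvZ.
  have ab_free c d : c *: a + d *: b = 0 -> c = 0 /\ d = 0.
    by move=> ab0; apply: (uw_free x) => //; have := cdab c d; rewrite ab0 subr0.
  have dl : \dim l = 2%N.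
    have a0 : a != 0.
      apply/eqP=> a0; have [|/eqP] := ab_free 1 0; last by rewrite oner_eq0.
      by rewrite a0 scaler0 scale0r addr0.
    have b0 : b != 0.
      apply/eqP=> b0; have [|_ /eqP] := ab_free 0 1; last by rewrite oner_eq0.
      by rewrite b0 scaler0 scale0r addr0.
    rewrite dimv_disjoint_sum ?dim_vline ?a0 ?b0 //.
    apply/eqP; rewrite -subv0; apply/subvP=> v; rewrite memv_cap memv0.
    case/andP=> /vlineP[c vc] /vlineP[d vd].
    have [|c0 _] := ab_free c (- d); first by rewrite scaleNr -vc -vd subrr.
    by rewrite vc c0 scale0r.
  have lP v : v \in l -> exists c d, v = c *: a + d *: b.
    by case/memv_addP=> _ /vlineP[c ->] [_ /vlineP[d ->] ->]; exists c, d.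
  have meetsl v k : v != 0 -> v \in l -> v \in sc i k -> meets l (sc i k :&: W).
    move=> v0 vl vk; apply: contraNneq v0 => lk.
    by rewrite -memv0 -lk !memv_cap vl vk (subvP lW).
  have abl c d : c *: a + d *: b \in l.
    by apply: memv_add; apply: memvZ; apply: memv_line.
  have [|||||||lR1 lR2] := Rline l (sc i j1 :&: W)%VS (sc i j2 :&: W)%VS
    (sc i jinf :&: W)%VS lW dl; rewrite ?sR ?inE ?eqxx ?orbT //.
  - by rewrite /= !inE negb_or !capW_neq.
  - apply: (meetsl (1 *: a + 0 *: b)) => //.
      by apply/eqP => /ab_free[/eqP]; rewrite oner_eq0.
    rewrite scale1r scale0r addr0; exact: sec_proj ua (memA x).
  - apply: (meetsl (1 *: a + 1 *: b)) => //.
      by apply/eqP => /ab_free[/eqP]; rewrite oner_eq0.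
    apply: sec_proj (cdab 1 1) _; rewrite !scale1r /u /w.
    have -> : x *m (Q1 + A *m Q2) + x *m (B - A) *m Q2 = x *m (Q1 + B *m Q2).
      by rewrite -mulmxA -mulmxDr -addrA -mulmxDl [A + _]addrC subrK.
    exact: memB.
  - apply: (meetsl (0 *: a + 1 *: b)) => //.
      by apply/eqP => /ab_free[_ /eqP]; rewrite oner_eq0.
    rewrite scale1r scale0r add0r; apply: sec_proj wb _.
    exact: memI.
  split=> [D DR | c d].
    have := lR1 D DR; rewrite /meets => lD.
    have := memv_pick (l :&: D); rewrite memv_cap => /andP[/lP[c [d e]] vD].
    exists c, d; split; last by exists (vpick (l :&: D)); rewrite // e.
    rewrite -negb_and; apply: contra lD => /andP[/eqP c0 /eqP d0].
    by rewrite -vpick0 e c0 d0 !scale0r addr0.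
  by have [D DR vD] := lR2 _ (abl c d); exists D => //; exists (c *: a + d *: b).
pose x0 : 'rV[F]_n := delta_mx 0 0.
have x00 : x0 != 0.
  by apply/eqP=> /rowP/(_ 0); rewrite !mxE !eqxx => /eqP; rewrite oner_eq0.
have [D DR [v0 v0D v0E]] := (line_x x0 x00).2 1 t.
have : D \in Delta pi tau i W := RD _ DR.
rewrite Delta_sec // => /mapP[k _ eD].
pose f x c := u x + c *: w x.
have fk0 : f x0 t \in sc i k.
  rewrite /f -[u x0]scale1r -[X in X \in _](subrK v0); apply: memvD.
    exact: pi_sec.
  by move: v0D; rewrite eD memv_cap => /andP[].
have fE x c : f x c = x *m Q1 + (x *m A + c *: (x *m (B - A))) *m Q2.
  by rewrite /f /u /w mulmxDr mulmxDl mulmxA -addrA scalemxAl.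
have nk : k != jinf.
  apply: contraNneq x00 => ek; move: fk0; rewrite ek fE => /memQinf ->.
  by [].
have wk x : w x \in sc i k -> x = 0.
  move=> wxk; have : w x \in pi i.
    by rewrite -(sec_cap n_gt0 oval_pi tan_tau i nk) memv_cap wxk /= memI.
  have [// | xn0] := eqVneq x 0.
  have := uw_free x 0 1 xn0; rewrite scale0r add0r scale1r => h /h[_ /eqP].
  by rewrite oner_eq0.
have fex x : exists c, f x c \in sc i k.
  have [-> | xn0] := eqVneq x 0.
    by exists 0; rewrite /f /u scale0r addr0 mul0mx mem0v.
  have [c [d [cd [v vD vE]]]] := (line_x x xn0).1 D DR.
  have cdk : c *: u x + d *: w x \in sc i k.
    rewrite -[X in X \in _](subrK v); apply: memvD; first exact: pi_sec.
    by move: vD; rewrite eD memv_cap => /andP[].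
  have c0 : c != 0.
    apply: contraTneq cd => c0; rewrite c0 eqxx /= negbK.
    move: cdk; rewrite c0 scale0r add0r /w !scalemxAl -/(w (d *: x)) => /wk/eqP.
    by rewrite scaler_eq0 (negPf xn0) orbF.
  exists (c^-1 * d); rewrite /f -[u x]scale1r -(mulVf c0) -!scalerA -scalerDr.
  exact: memvZ.
have ft x : f x t \in sc i k.
  have [/existsP[c /eqP ->] | ] := boolP [exists c, x == c *: x0].
    have -> : f (c *: x0) t = c *: f x0 t.
      by rewrite /f /u /w scalerDr -!scalemxAl !scalerA [t * c]mulrC.
    exact: memvZ.
  rewrite negb_exists => /forallP xx0.
  have [c fc] := fex x; have [d fd] := fex (x + x0).
  (* The left side lies in the member at infinity and the right side in [sc i k], so by [wk] the
     argument of [w] vanishes. As x is not a multiple of x0, this gives d = c = t. *)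
  have e : w ((d - c) *: x + (d - t) *: x0) = f (x + x0) d - f x c - f x0 t.
    have uD y z : u (y + z) = u y + u z by rewrite /u mulmxDl.
    have wD y z : w (y + z) = w y + w z by rewrite /w !mulmxDl.
    have wZ (a : F) y : w (a *: y) = a *: w y by rewrite /w -!scalemxAl.
    rewrite /f uD !wD !wZ !scalerBl scalerDr -[RHS]addrA -opprD.
    rewrite [u x + c *: _ + _]addrACA opprD [RHS]addrACA subrr add0r.
    by rewrite opprD addrACA.
  have /wk/eqP : w ((d - c) *: x + (d - t) *: x0) \in sc i k.
    by rewrite e; apply: memvB => //; apply: memvB.
  rewrite addr_eq0 => /eqP dx.
  have dc : d - c = 0.
    apply/eqP; apply: contraT => dc0; have /eqP[] := xx0 (- ((d - c)^-1 * (d - t))).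
    by rewrite -(scalerK dc0 x) dx scalerN scalerA scaleNr.
  move: dx; rewrite dc scale0r => /esym/eqP; rewrite oppr_eq0 scaler_eq0.
  rewrite (negPf x00) orbF subr_eq0 => /eqP <-.
  by move/subr0_eq: dc => ->.
exists k; rewrite /has_slope.
apply/esym/eqP; rewrite eqEdim; apply/andP; split.
  rewrite subv_add pi_sub_sec //=; apply: rowspan_sub => x.
  by rewrite mulmxDr mulmxA [x *m (A + _)]mulmxDr -scalemxAr -fE.
rewrite dim_sec // dimv_disjoint_sum.
  rewrite dim_pi dim_rowspan; first by rewrite mul2n addnn.
  move=> x; rewrite mulmxDr mulmxA => e.
  by have /Qfree[] : x *m Q1 + x *m (A + t *: (B - A)) *m Q2 \in pi i by rewrite e mem0v.
apply/eqP; rewrite -subv0; apply/subvP=> v; rewrite memv_cap memv0.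
case/andP=> vp /rowspanP[x vx]; move: vp; rewrite vx mulmxDr mulmxA.
by case/Qfree=> -> _; rewrite !mul0mx addr0.
Qed.

End Slopes.

(** The second closure is the first one for the exchanged frame [Q2], [Q1]: there [j0] is the member
    at infinity, [jinf] has slope 0, and the other slopes are inverted. *)
Lemma slope_set_line_closed Q1 Q2 jinf j0 (M : I -> 'M[F]_n) :
    (forall x y : 'rV[F]_n, x *m Q1 + y *m Q2 \in pi i -> x = 0 /\ y = 0) ->
    sc i jinf = (pi i + rowspan Q2)%VS ->
    (forall k, k != jinf -> has_slope Q1 Q2 k (M k)) ->
    j0 != jinf -> M j0 = 0 ->
    (forall k, k != jinf -> k != j0 -> M k \in unitmx) ->
  line_closed (mem [set M k | k in predC1 jinf]) /\
  line_closed (fun A => A^-1 \in [set M k | k in predC1 jinf]).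
Proof.
move=> Qfree Qinf slM j0inf M0 unitM; split.
  move=> _ _ t /imsetP[k1 k1i ->] /imsetP[k2 k2i ->].
  have [k slk] := has_slope_line Qfree Qinf t (slM _ k1i) (slM _ k2i).
  have ki := has_slope_neq_inf Qfree Qinf slk; apply/imsetP; exists k => //.
  exact: (has_slope_uniq Qfree slk (slM k ki)).
have Qfree' (x y : 'rV[F]_n) : x *m Q2 + y *m Q1 \in pi i -> x = 0 /\ y = 0.
  by rewrite addrC => /Qfree[].
have V0 : (0 : 'M[F]_n)^-1 = 0 by rewrite invr_out ?unitr0.
have Qinf' : sc i j0 = (pi i + rowspan Q1)%VS.
  by rewrite (slM _ j0inf) M0 mul0mx addr0.
have slinf : has_slope Q2 Q1 jinf 0 by rewrite /has_slope mul0mx addr0.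
have inv_slope A : A^-1 \in [set M k | k in predC1 jinf] ->
    exists k, has_slope Q2 Q1 k A.
  case/imsetP=> k ki /(canRL invrK) ->; have [-> | kj] := eqVneq k j0.
    by exists jinf; rewrite M0 V0.
  by exists k; apply: has_slope_swap (unitM k ki kj) (slM k ki).
move=> A B t /inv_slope[k1 sl1] /inv_slope[k2 sl2].
have [k slk] := has_slope_line Qfree' Qinf' t sl1 sl2.
have kj := has_slope_neq_inf Qfree' Qinf' slk.
(* The slope 0 of [jinf] in the exchanged frame is its own [^-1], and it is the slope of [j0] in the
   original one. *)
have [ki | ki] := eqVneq k jinf.
  rewrite ki in slk; rewrite (has_slope_uniq Qfree' slk slinf) V0.
  by apply/imsetP; exists j0.
have := has_slope_swap (unitM k ki kj) (slM k ki).
move/(has_slope_uniq Qfree' slk) ->; apply/imsetP; exists k => //.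
exact: invrK.
Qed.

End SpreadSets.

Lemma unitmx_inj (K : fieldType) p (X : 'M[K]_p) :
  (forall x : 'rV[K]_p, x *m X = 0 -> x = 0) -> X \in unitmx.
Proof. by move=> X_inj; rewrite -row_free_unit; apply: inj_row_free. Qed.

Lemma addv_rowspan_mod (K : fieldType) r p (U : {vspace 'rV[K]_r})
    (M N : 'M[K]_(p, r)) :
  (forall x, x *m N \in U) -> (U + rowspan (M + N) = U + rowspan M)%VS.
Proof.
move=> NU; apply/eqP; rewrite eqEsubv !subv_add !addvSl /=; apply/andP; split.
  apply: rowspan_sub => x; rewrite mulmxDr addrC.
  by apply: memv_add => //; apply: mem_rowspan.
apply: rowspan_sub => x.
have -> : x *m M = - (x *m N) + x *m (M + N) by rewrite mulmxDr addrC addrK.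
by apply: memv_add; [rewrite memvN | apply: mem_rowspan].
Qed.

(** * Coordinates of the oval over a frame containing the nucleus *)

Section Coordinates.

Variables (F : finFieldType) (m : nat).
Local Notation n := m.+1.
Local Notation V := 'rV[F]_(3 * n).
Local Notation q := #|F|.
Local Notation I := 'I_(q ^ n).+1.
Variables (pi tau W : I -> {vspace V}).
Hypothesis oval_pi : pseudo_oval pi.
Hypothesis tan_tau : forall i, tangent_space pi i (tau i).
Hypothesis compW : forall i, \dim (W i) = (2 * n)%N /\ disjoint_spaces (W i) (pi i).
Hypothesis regW : forall i, regular_spread n (W i) (Delta pi tau i (W i)).
Local Notation sc := (sec pi tau).
Local Notation slope_at := (has_slope pi tau).

Let n_gt0 : (0 < n)%N := ltn0Sn m.

Variables (oo i0 : I) (P0 P1 P2 : 'M[F]_(n, 3 * n)) (A B : I -> 'M[F]_n).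
Hypothesis free3 : forall x y z : 'rV[F]_n,
  x *m P0 + y *m P1 + z *m P2 = 0 -> [/\ x = 0, y = 0 & z = 0].
Hypothesis pi_ooE : pi oo = rowspan P2.
Hypothesis tauE : forall i, tau i = (pi i + rowspan P1)%VS.
Hypothesis piE : forall i, i != oo ->
  pi i = rowspan (P0 + A i *m P1 + B i *m P2).
Hypotheses (i0oo : i0 != oo) (A0 : A i0 = 0) (B0 : B i0 = 0).

Local Notation P i := (P0 + A i *m P1 + B i *m P2).

Let memP i (x : 'rV_n) : i != oo -> x *m P i \in pi i.
Proof. by move=> ioo; rewrite piE // mem_rowspan. Qed.

Let mulP i (x : 'rV_n) :
  x *m P i = x *m P0 + x *m A i *m P1 + x *m B i *m P2.
Proof. by rewrite !mulmxDr !mulmxA. Qed.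

Let P_inj i (x : 'rV_n) : x *m P i = 0 -> x = 0.
Proof. by rewrite mulP => /free3[]. Qed.

(** A vector killed by the difference would make <pi_oo, pi_i> and <pi_oo, pi_j> meet outside
    pi_oo. *)
Lemma coordA_unit i j : i != oo -> j != oo -> i != j -> A i - A j \in unitmx.
Proof.
move=> ioo joo ij; apply: unitmx_inj => x; rewrite mulmxBr => /subr0_eq xA.
apply: (@P_inj i); apply/eqP; rewrite -memv0.
rewrite -(cap_pi_pi n_gt0 oval_pi ioo) memv_cap memP //=.
rewrite -(sec_cap n_gt0 oval_pi tan_tau oo ij) memv_cap /sec (negPf ioo) (negPf joo).
rewrite (subvP (addvSr _ _) _ (memP x ioo)) /=.
have -> : x *m P i = x *m (B i - B j) *m P2 + x *m P j.
  rewrite !mulP xA mulmxBr mulmxBl [RHS]addrC -[RHS]addrA; congr (_ + _).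
  by rewrite addrC subrK.
by apply: memv_add; rewrite ?memP // pi_ooE mem_rowspan.
Qed.

(** A vector killed by the difference would give a common vector of pi_i and tau_j = pi_j + N, where
    N is the row space of [P1]. *)
Lemma coordB_unit i j : i != oo -> j != oo -> i != j -> B i - B j \in unitmx.
Proof.
move=> ioo joo ij; apply: unitmx_inj => x; rewrite mulmxBr => /subr0_eq xB.
apply: (@P_inj i); apply/eqP; rewrite -memv0.
have [_ _ /(_ i ij) <-] := tan_tau j.
rewrite memv_cap memP // andbT tauE.
have -> : x *m P i = x *m P j + x *m (A i - A j) *m P1.
  rewrite !mulP xB mulmxBr mulmxBl [RHS]addrAC; congr (_ + _).
  by rewrite -[RHS]addrA [x *m A j *m P1 + _]addrC subrK.
by apply: memv_add; rewrite ?memP // mem_rowspan.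
Qed.

Lemma slope_infty k : k != oo -> slope_at oo P0 P1 k (A k).
Proof.
move=> koo; rewrite /has_slope /sec (negPf koo) [pi k]piE // addv_rowspan_mod // => x.
by rewrite mulmxA pi_ooE mem_rowspan.
Qed.

Lemma free_infty (x y : 'rV[F]_n) : x *m P0 + y *m P1 \in pi oo ->
  x = 0 /\ y = 0.
Proof.
rewrite pi_ooE => /rowspanP[z e]; have := free3 (x := x) (y := y) (z := - z).
by rewrite e mulNmx subrr => -[].
Qed.

Lemma sec_infty : sc oo oo = (pi oo + rowspan P1)%VS.
Proof. by rewrite /sec eqxx tauE. Qed.

Definition coord_slope b k := (A k - A b)^-1 * (B k - B b).

(** The difference of the matrices of pi_k and pi_b is (A k - A b)(P1 + M P2) with M the slope. For
    k = b the convention 0^-1 = 0 gives slope 0, in agreement with tau_b = pi_b + N. *)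
Lemma slope_point b k : b != oo -> k != oo ->
  slope_at b P1 P2 k (coord_slope b k).
Proof.
move=> boo koo; rewrite /has_slope /sec; have [-> | kb] := eqVneq k b.
  by rewrite tauE /coord_slope !subrr mulr0 mul0mx addr0.
have uA := coordA_unit koo boo kb.
rewrite [pi k]piE // -(rowspan_unit (P1 + _) uA).
have -> : P k = (A k - A b) *m (P1 + coord_slope b k *m P2) + P b.
  have sE : (A k - A b) *m coord_slope b k = B k - B b by apply: mulVKr.
  rewrite [_ *m (P1 + _)]mulmxDr [_ *m (coord_slope _ _ *m _)]mulmxA sE.
  rewrite !mulmxBl [RHS]addrACA subrK; congr (_ + _).
  by rewrite [P0 + A b *m P1]addrC addrA subrK addrC.
by rewrite addv_rowspan_mod // => x; apply: memP.
Qed.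

Lemma free_point b (x y : 'rV[F]_n) : b != oo ->
  x *m P1 + y *m P2 \in pi b -> x = 0 /\ y = 0.
Proof.
move=> boo; rewrite piE // => /rowspanP[z]; rewrite mulP => e.
have [|z0 x0 y0] := free3 (x := z) (y := z *m A b - x) (z := z *m B b - y).
  by rewrite !mulmxBl [z *m P0 + _]addrA addrACA -opprD -e subrr.
by move: x0 y0; rewrite z0 !mul0mx => /subr0_eq <- /subr0_eq <-.
Qed.

Variable i1 : I.
Hypotheses (i1oo : i1 != oo) (A1 : A i1 = 1).
Variables (L : splittingFieldType F) (t : F).
Hypotheses (dimL : \dim {:L} = n) (prime_n : prime n).
Hypotheses (t0 : t != 0) (t1 : t != 1).

Let K := [set A k | k in predC1 oo].

Lemma coordA_inj : {in predC1 oo &, injective A}.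
Proof.
move=> i j ioo joo Aij; apply/eqP; apply: contraT => ij.
by have := coordA_unit ioo joo ij; rewrite Aij subrr unitr0.
Qed.

Lemma mxfield_coordA : mxfield K.
Proof.
have K1 : 1 \in K by apply/imsetP; exists i1.
(* Since A i1 = 1, the normalising factor of [spread_set_mxfield] can be taken to be 1. *)
suff: mxfield [set a * 1^-1 | a in K].
  by congr mxfield; rewrite -[RHS]imset_id; apply: eq_imset => a; rewrite invr1 mulr1.
have [|||||lineK invK] := @slope_set_line_closed _ _ _ _ oval_pi tan_tau oo (W oo)
  (compW oo).1 (compW oo).2 (regW oo) P0 P1 oo i0 A free_infty.
- exact: sec_infty.
- exact: slope_infty.
- exact: i0oo.
- exact: A0.
- by move=> k koo ki; have := coordA_unit koo i0oo ki; rewrite A0 subr0.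
apply: (spread_set_mxfield t0 t1) => //.
- by rewrite card_in_imset ?cardC1 ?card_ord //; apply: coordA_inj.
- by apply/imsetP; exists i0; rewrite ?A0.
- move=> _ /imsetP[k koo ->]; have [-> | ki] := eqVneq k i0; first by left.
  by right; have := coordA_unit koo i0oo ki; rewrite A0 subr0.
exact: oner_neq0.
Qed.

(** [B] as a function of the matrix [A k]; the default index is reached only outside K. *)
Let g (a : 'M[F]_n) := B (odflt oo [pick k | (k != oo) && (A k == a)]).

Let gA k : k != oo -> g (A k) = B k.
Proof.
move=> koo; rewrite /g; case: pickP => [j /andP[joo /eqP Aj] | /(_ k)] /=.
  by rewrite (coordA_inj joo koo Aj).
by rewrite koo eqxx.
Qed.

Let slopesE b : b != oo -> slopes K g (A b) = [set coord_slope b k | k in predC1 oo].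
Proof.
move=> boo; rewrite /slopes /K -imset_comp; apply: eq_in_imset => k koo.
by rewrite /= /slope /coord_slope !gA.
Qed.

Lemma coord_field : mxfield K /\
  exists2 s, s \is a GRing.unit & forall k, k != oo -> B k * s^-1 \in K.
Proof.
have fK := mxfield_coordA; split=> //.
have lines b : b != oo -> line_closed (mem (slopes K g (A b))) /\
    line_closed (fun X => X^-1 \in slopes K g (A b)).
  move=> boo; rewrite slopesE //.
  (* Seen from b, the member of index [oo] is at infinity and the tangent member, of index b itself,
     has slope 0. *)
  apply: (@slope_set_line_closed _ _ _ _ oval_pi tan_tau b (W b)
    (compW b).1 (compW b).2 (regW b) P1 P2 oo b (coord_slope b)) => //.
  - by move=> x y; apply: free_point.
  - by rewrite /sec eq_sym (negPf boo) pi_ooE.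
  - by move=> k; apply: slope_point.
  - by rewrite /coord_slope !subrr mulr0.
  move=> k koo kb; rewrite [_ \in _]unitrMr ?coordB_unit //.
  by rewrite unitrV; apply: coordA_unit.
have [||||| s us gs] := @slopes_common_field _ _ _ dimL prime_n t t0 t1 K g fK.
- by rewrite -[X in g X]A0 gA.
- move=> _ _ /imsetP[i ioo ->] /imsetP[j joo ->] Aij; rewrite !gA //.
  by apply: coordB_unit => //; apply: contra Aij => /eqP ->.
- move=> _ /imsetP[b boo ->] _ _ /imsetP[i ioo ->] /imsetP[j joo ->].
  rewrite /slope !gA // -!/(coord_slope _ _) => eij.
  have e : sc b i = sc b j.
    by rewrite (slope_point boo ioo) (slope_point boo joo) eij.
  by rewrite (sec_inj oval_pi tan_tau e).
- by move=> _ /imsetP[b boo ->]; case: (lines b boo).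
- by move=> _ /imsetP[b boo ->]; case: (lines b boo).
by exists s => // k koo; rewrite -gA // gs //; apply/imsetP; exists k.
Qed.

End Coordinates.

(** * Field reduction by means of an eigenvector of a matrix field *)

Section OvalFromField.

Variables (F : finFieldType) (L : splittingFieldType F) (m : nat).
Local Notation n := m.+1.
Local Notation q := #|F|.
Local Notation V := 'rV[F]_(3 * n).
Local Notation VL := 'rV[L]_(3 * n).
Local Notation iota := (in_alg L).
Local Notation G := ('Gal({:L} / 1)%g).
Local Notation ext := (map_mx iota).
Hypotheses (dimL : \dim {:L} = n) (prime_n : prime n).

Lemma conj_spanS (U U' : {vspace VL}) :
  (U <= U')%VS -> (conj_span U <= conj_span U')%VS.
Proof.
move=> sU; apply/subv_sumP=> s sG.
exact: subv_trans (conj_spaceS s sU) (sumv_sup s sG (subvv _)).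
Qed.

Lemma rational_full (U : {vspace VL}) : (forall v : V, ext v \in U) -> U = fullv.
Proof.
move=> rU; apply/eqP; rewrite eqEsubv subvf /=; apply/subvP=> v _.
rewrite (row_sum_delta v) memv_suml // => j _; rewrite memvZ //.
have := rU (delta_mx 0 j); rewrite map_delta_mx; exact.
Qed.

Lemma mem_rowspan_submx (K : fieldType) p r (M : 'M[K]_(p, r)) v :
  (v \in rowspan M) = (v <= M)%MS.
Proof. by apply/rowspanP/submxP=> -[x ->]; exists x. Qed.

Lemma mem_rowspan_ext p (M : 'M[F]_(p, 3 * n)) v :
  (ext v \in rowspan (ext M)) = (v \in rowspan M).
Proof. by rewrite !mem_rowspan_submx map_submx. Qed.

Section Eigenvector.

Variables (a : 'M[F]_n) (l : L) (w : 'rV[L]_n).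
Hypotheses (w0 : w != 0) (wa : w *m ext a = l *: w).
Hypothesis gen_l : <<1; l>>%VS = fullv.

Lemma gal_eigenvalue_inj : {in G &, injective (fun s : gal_of {:L} => s l)}.
Proof.
move=> s s' _ _ /= ss'; apply/eqP/gal_eqP=> y _.
have : y \in <<1; l>>%VS by rewrite gen_l memvf.
case/Fadjoin_polyP=> p /polyOver1P[p0 ->] ->.
have h (r : gal_of {:L}) : r (map_poly iota p0).[l] = (map_poly iota p0).[r l].
  rewrite -[LHS]horner_map -map_poly_comp; congr (_.[_]).
  by apply: eq_map_poly => k /=; rewrite rmorph_alg.
by rewrite !h ss'.
Qed.

Lemma gal_eigen (s : gal_of {:L}) : map_mx s w *m ext a = s l *: map_mx s w.
Proof. by rewrite -[ext a](map_mx_gal_iota s) -map_mxM wa map_mxZ. Qed.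

(** The n conjugates of [w] are eigenvectors for distinct eigenvalues, so the eigenspaces are
    one-dimensional and span everything. *)
Lemma conj_eigen_span (x : 'rV[L]_n) :
  exists c : gal_of {:L} -> L, x = \sum_(s in G) c s *: map_mx s w.
Proof.
pose E (s : gal_of {:L}) := eigenspace (ext a) (s l).
have wE (s : gal_of {:L}) : (map_mx s w <= E s)%MS by apply/eigenspaceP; apply: gal_eigen.
have w0s (s : gal_of {:L}) : map_mx s w != 0 by rewrite map_mx_eq0.
have rw (s : gal_of {:L}) : \rank (map_mx s w) = 1%N by rewrite rank_rV w0s.
have rE (s : gal_of {:L}) : (1 <= \rank (E s))%N by rewrite -(rw s) mxrankS.
have := mxdirect_sum_eigenspace (ext a) gal_eigenvalue_inj.
move/mxdirectP => /= rsum.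
have rle : (\sum_(s in G) \rank (E s) <= n)%N by rewrite -rsum rank_leq_row.
have cG : #|G| = n := card_gal dimL.
have req : (\sum_(s in G) \rank (E s) = n)%N.
  apply/eqP; rewrite eqn_leq rle -{1}cG -sum1_card.
  by apply: leq_sum => s _; apply: rE.
have r1 (s : gal_of {:L}) : s \in G -> \rank (E s) = 1%N.
  move=> sG; have := leqif_sum (fun s (_ : s \in G) => leqif_eq (rE s)).
  rewrite sum1_card req cG => -[_]; rewrite eqxx => /esym/forallP/(_ s).
  by rewrite sG => /eqP.
have full : (x <= \sum_(s in G) E s)%MS.
  by apply: submx_full; rewrite /row_full rsum req.
have /sub_sumsmxP[u ->] := full.
have ex (s : gal_of {:L}) : exists c : L, s \in G -> u s *m E s = c *: map_mx s w.
  have [sG | sG] := boolP (s \in G); last by exists 0.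
  have : (u s *m E s <= map_mx s w)%MS.
    apply: submx_trans (submxMl _ _) _.
    by rewrite -(mxrank_leqif_sup (wE s)).2 rw r1.
  by case/sub_rVP=> c ->; exists c.
have [c cE] := fin_all_exists ex; exists c.
by apply: eq_bigr => s sG; apply: cE.
Qed.

Lemma conj_span_eigen (M : 'M[F]_(n, 3 * n)) :
  conj_span <[w *m ext M]>%VS = rowspan (ext M).
Proof.
apply/eqP; rewrite eqEsubv; apply/andP; split.
  apply/subv_sumP=> s _; apply/subvP=> v; rewrite mem_conj_spaceE.
  case/vlineP=> c /(congr1 (map_mx s)).
  rewrite -map_mx_galM mulVg map_mx_gal1 map_mxZ map_mxM map_mx_gal_iota => ->.
  by rewrite scalemxAl mem_rowspan.
apply: rowspan_sub => x; have [c ->] := conj_eigen_span x.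
rewrite mulmx_suml; apply: memv_sumr => s sG; rewrite -scalemxAl memvZ //.
have -> : map_mx s w *m ext M = map_mx s (w *m ext M).
  by rewrite map_mxM map_mx_gal_iota.
by rewrite mem_conj_space memv_line.
Qed.

End Eigenvector.

(** A common eigenvector w of K turns the coordinates A_i and B_i into scalars of [L]. So the points
    w P_i lie in the plane spanned by w P0, w P1 and w P2, and by [conj_span_eigen] the conjugates
    of w P_i span the extension of pi_i. *)
Lemma regular_of_field (pi : 'I_(q ^ n).+1 -> {vspace V}) oo
    (P0 P1 P2 : 'M[F]_(n, 3 * n)) (A B : 'I_(q ^ n).+1 -> 'M[F]_n) K :
    pseudo_oval pi -> mxfield K ->
    (forall v : V, exists x y z : 'rV[F]_n, v = x *m P0 + y *m P1 + z *m P2) ->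
    pi oo = rowspan P2 ->
    (forall i, i != oo -> pi i = rowspan (P0 + A i *m P1 + B i *m P2)) ->
    (forall i, i != oo -> A i \in K /\ B i \in K) ->
  regular_pseudo_oval L pi.
Proof.
move=> oval_pi fK span3 pi_oo piE ABK.
have [pi_inj dim_pi pi_span] := oval_pi.
have [a aK nsa] := mxfield_nonscalar prime_n fK.
have [l [w [w0 wa gen_l]]] :=
  nonscalar_eigen dimL prime_n (mxfield_unit_poly fK aK) nsa.
have eigK X : X \in K -> exists c, w *m ext X = c *: w.
  case/(mxfield_gen dimL prime_n fK aK nsa)=> p ->.
  by exists (map_poly iota p).[l]; rewrite map_horner_mx (horner_mx_eigen _ wa).
pose P i := if i == oo then P2 else P0 + A i *m P1 + B i *m P2.
have {}piE i : pi i = rowspan (P i).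
  by rewrite /P; case: eqVneq => [-> // | ioo]; apply: piE.
pose x i := <[w *m ext (P i)]>%VS.
pose xi := (<[w *m ext P0]> + <[w *m ext P1]> + <[w *m ext P2]>)%VS.
have csE M := conj_span_eigen w0 wa gen_l M.
have mem_pi i v : (v \in pi i) = (ext v \in conj_span (x i)).
  by rewrite csE mem_rowspan_ext piE.
have x_xi i : (x i <= xi)%VS.
  rewrite -memvE /P; case: eqVneq => [_ | ioo].
    by apply: subvP (addvSr _ _) _ (memv_line _).
  have [/eigK[c wA] /eigK[d wB]] := ABK i ioo.
  rewrite !map_mxD !map_mxM !mulmxDr !mulmxA wA wB -!scalemxAl.
  by rewrite !memv_add ?memvZ ?memv_line.
(* The conjugates of a d-dimensional space span at most n d dimensions. This bounds the dimension of
   [xi] from below and also shows that no three points of the oval are collinear. *)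
have full_dim (U : {vspace VL}) : conj_span U = fullv -> (2 < \dim U)%N.
  move=> fU; have := dim_conj_span dimL U; rewrite fU dimvf dim_matrix mul1r.
  by move: (\dim U) => d; rewrite mulnC leq_pmul2l.
have cs_sub (M : 'M[F]_(n, 3 * n)) (y : 'rV[L]_n) :
    (<[w *m ext M]> <= xi)%VS -> y *m ext M \in conj_span xi.
  by move=> sM; apply: subvP (conj_spanS sM) _ _; rewrite csE mem_rowspan.
have span_xi : conj_span xi = fullv.
  apply: rational_full => v; have [y0 [y1 [y2 ->]]] := span3 v.
  rewrite !map_mxD !map_mxM; apply: memvD; first apply: memvD.
  - by apply: cs_sub; rewrite /xi -addvA addvSl.
  - by apply: cs_sub; apply: subv_trans (addvSr _ _) (addvSl _ _).
  by apply: cs_sub; apply: addvSr.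
have dim_xi : \dim xi = 3%N.
  apply/eqP; rewrite eqn_leq full_dim // andbT.
  have := dimv_sum_cap (<[w *m ext P0]> + <[w *m ext P1]>) <[w *m ext P2]>.
  have := dimv_sum_cap <[w *m ext P0]> <[w *m ext P1]>.
  by rewrite -/xi !dim_vline; do 3!case: (_ != 0); clear; lia.
exists \1%VF; split.
  by apply/eqP; apply/lker0P => u v; rewrite !id_lfunE.
exists xi, x; split=> //; last by move=> i v; rewrite lim1g.
split.
- move=> i j xij; apply: pi_inj; apply/vspaceP=> v.
  by rewrite !mem_pi xij.
- move=> i; split=> //; rewrite dim_vline; case: eqP => // xi0.
  have : pi i != 0%VS by rewrite -dimv_eq0 dim_pi.
  rewrite -vpick0; have := memv_pick (pi i).
  have := dim_conj_span dimL (x i); rewrite dim_vline xi0 eqxx muln0 leqn0 dimv_eq0.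
  rewrite mem_pi => /eqP ->; rewrite memv0 map_mx_eq0 => /eqP ->.
  by rewrite eqxx.
move=> i j k ijk; apply: full_dim; apply: rational_full => v.
have : v \in (pi i + pi j + pi k)%VS by rewrite pi_span // memvf.
case/memv_addP=> _ /memv_addP[v1 v1i [v2 v2j ->]] [v3 v3k ->].
move: v1i v2j v3k; rewrite !mem_pi !map_mxD => v1i v2j v3k.
apply: memvD; first apply: memvD.
- by apply: subvP v1i; apply: conj_spanS; rewrite -addvA addvSl.
- by apply: subvP v2j; apply: conj_spanS; apply: subv_trans (addvSr _ _) (addvSl _ _).
by apply: subvP v3k; apply: conj_spanS; apply: addvSr.
Qed.

End OvalFromField.

(** * The frame given by two members and the nucleus *)

Section RegularSpreadsRegularOval.

Variables (F : finFieldType) (L : splittingFieldType F) (m : nat).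
Local Notation n := m.+1.
Local Notation q := #|F|.
Local Notation V := 'rV[F]_(3 * n).
Local Notation I := 'I_(q ^ n).+1.
Variables (pi tau W : I -> {vspace V}).
Hypothesis oval_pi : pseudo_oval pi.
Hypothesis tan_tau : forall i, tangent_space pi i (tau i).
Hypothesis even_q : ~~ odd q.

Let n_gt0 : (0 < n)%N := ltn0Sn m.

Variables (oo i0 : I) (P0 P1 P2 : 'M[F]_(n, 3 * n)).
Hypothesis i0oo : i0 != oo.
Hypotheses (pi0E : pi i0 = rowspan P0) (pi_ooE : pi oo = rowspan P2).
Hypothesis nucE : (tau oo :&: tau i0)%VS = rowspan P1.
Hypothesis P0_inj : forall x : 'rV[F]_n, x *m P0 = 0 -> x = 0.
Hypothesis P1_inj : forall x : 'rV[F]_n, x *m P1 = 0 -> x = 0.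
Hypothesis P2_inj : forall x : 'rV[F]_n, x *m P2 = 0 -> x = 0.

(** The nucleus lies in the tangent space at some other member, which is skew to pi_i. *)
Lemma pi_cap_nucleus i : (pi i :&: rowspan P1 = 0)%VS.
Proof.
have [j ji nj] : exists2 j, i != j & (rowspan P1 <= tau j)%VS.
  have [-> | ioo] := eqVneq i oo.
    by exists i0; [rewrite eq_sym | rewrite -nucE capvSr].
  by exists oo => //; rewrite -nucE capvSl.
have [_ _ /(_ i ji) cap0] := tan_tau j.
by apply/eqP; rewrite -subv0 -cap0 [(tau j :&: _)%VS]capvC capvS.
Qed.

Lemma tau_nucleus i : tau i = (pi i + rowspan P1)%VS.
Proof.
have [pt dt _] := tan_tau i.
have ooi0 : oo != i0 by rewrite eq_sym.
apply/esym/eqP; rewrite eqEdim subv_add pt -nucE.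
rewrite (nucleus n_gt0 oval_pi tan_tau i even_q ooi0) /=.
rewrite nucE dt dimv_disjoint_sum ?pi_cap_nucleus // dim_rowspan //.
by case: oval_pi => _ -> _; rewrite mul2n addnn.
Qed.

Lemma frame_free (x y z : 'rV[F]_n) :
  x *m P0 + y *m P1 + z *m P2 = 0 -> [/\ x = 0, y = 0 & z = 0].
Proof.
move=> e; have x0 : x = 0.
  apply: P0_inj; apply/eqP; rewrite -memv0.
  have [_ _ /(_ i0 i0oo) <-] := tan_tau oo.
  rewrite memv_cap pi0E mem_rowspan andbT tau_nucleus pi_ooE.
  move/eqP: e; rewrite -addrA addr_eq0 => /eqP ->; rewrite memvN addrC.
  by apply: memv_add; apply: mem_rowspan.
move: e; rewrite x0 mul0mx add0r => /eqP; rewrite addr_eq0 => /eqP e.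
have y0 : y = 0.
  apply: P1_inj; apply/eqP; rewrite -memv0 -(pi_cap_nucleus oo) memv_cap.
  by rewrite mem_rowspan andbT e memvN pi_ooE mem_rowspan.
split=> //; apply: P2_inj; apply/eqP; rewrite -oppr_eq0 -e y0.
by rewrite mul0mx.
Qed.

Lemma frame_span (v : V) :
  exists x y z : 'rV[F]_n, v = x *m P0 + y *m P1 + z *m P2.
Proof.
have : v \in (tau oo + pi i0)%VS by rewrite tau_pi_full // memvf.
rewrite tau_nucleus pi_ooE pi0E.
case/memv_addP=> _ /memv_addP[_ /rowspanP[z ->] [_ /rowspanP[y ->] ->]]
  [_ /rowspanP[x ->] ->].
exists x, y, z.
by rewrite addrC [z *m _ + _]addrC addrA.
Qed.

Lemma frame_span_mx p (M : 'M[F]_(p, 3 * n)) :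
  exists X Y Z : 'M[F]_(p, n), M = X *m P0 + Y *m P1 + Z *m P2.
Proof.
have ex j : exists c : 'rV[F]_n * 'rV[F]_n * 'rV[F]_n,
    row j M = c.1.1 *m P0 + c.1.2 *m P1 + c.2 *m P2.
  by have [x [y [z e]]] := frame_span (row j M); exists (x, y, z).
have [f fE] := fin_all_exists ex.
exists (\matrix_j (f j).1.1), (\matrix_j (f j).1.2), (\matrix_j (f j).2).
by apply/row_matrixP=> j; rewrite fE !linearD /= !row_mul !rowK.
Qed.

(** The block of pi_i at [P0] is invertible because pi_i is skew to tau_oo, the span of the rows of
    [P1] and [P2]; dividing by this block normalises it to 1. *)
Lemma pi_coordinates i : i != oo ->
  exists A B : 'M[F]_n, pi i = rowspan (P0 + A *m P1 + B *m P2).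
Proof.
move=> ioo; have [_ /(_ i) dim_pi _] := oval_pi.
have [M piM M_inj] := rowspan_basis dim_pi.
have [X [Y [Z MXYZ]]] := frame_span_mx M.
have uX : X \in unitmx.
  apply: unitmx_inj => x xX; apply: M_inj; apply/eqP; rewrite -memv0.
  have [_ _ /(_ i ioo) <-] := tan_tau oo.
  rewrite memv_cap piM mem_rowspan andbT tau_nucleus pi_ooE MXYZ.
  rewrite !mulmxDr !mulmxA xX mul0mx add0r addrC.
  by apply: memv_add; apply: mem_rowspan.
exists (invmx X *m Y), (invmx X *m Z).
rewrite piM -(rowspan_unit M (_ : invmx X \in unitmx)) ?unitmx_inv //.
by rewrite MXYZ !mulmxDr !mulmxA mulVmx // mul1mx.
Qed.

Lemma regular_of_spreads (t : F) : \dim {:L} = n -> prime n ->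
    t != 0 -> t != 1 ->
    (forall i, \dim (W i) = (2 * n)%N /\ disjoint_spaces (W i) (pi i)) ->
    (forall i, regular_spread n (W i) (Delta pi tau i (W i))) ->
  regular_pseudo_oval L pi.
Proof.
move=> dimL prime_n t0 t1 compW regW.
have ex i : exists AB : 'M[F]_n * 'M[F]_n, i != oo ->
    pi i = rowspan (P0 + AB.1 *m P1 + AB.2 *m P2).
  have [-> | ioo] := eqVneq i oo; first by exists (0, 0).
  by have [A [B e]] := pi_coordinates ioo; exists (A, B).
have [AB ABE] := fin_all_exists ex.
have AB0 : AB i0 = (0, 0).
  have h (x : 'rV[F]_n) : x *m (AB i0).1 = 0 /\ x *m (AB i0).2 = 0.
    have : x *m (P0 + (AB i0).1 *m P1 + (AB i0).2 *m P2) \in pi i0.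
      by rewrite (ABE i0) // mem_rowspan.
    rewrite pi0E => /rowspanP[y]; rewrite !mulmxDr !mulmxA => /eqP.
    rewrite -subr_eq0 addrAC [_ + _ - y *m P0]addrAC -mulmxBl.
    by move/eqP/frame_free=> [].
  rewrite [AB i0]surjective_pairing; congr pair.
    by apply/row_matrixP=> j; rewrite rowE (h _).1 row0.
  by apply/row_matrixP=> j; rewrite rowE (h _).2 row0.
have [i1 i1oo i1i0] := third_index n_gt0 oo i0.
have ABE' i (ioo : i != oo) := ABE i ioo.
have us : (AB i1).1 \in unitmx.
  have := coordA_unit oval_pi tan_tau frame_free pi_ooE ABE' i1oo i0oo i1i0.
  by rewrite AB0 subr0.
set s := (AB i1).1 in us.
(* Rescaling [P1] by [s] makes A i1 = 1. Below, [P2] absorbs the right factor r in the same way,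
   which puts all coordinates into one field. *)
pose A i := (AB i).1 *m invmx s; pose B i := (AB i).2; pose P1' := s *m P1.
have P1'E : rowspan P1' = rowspan P1 by apply: rowspan_unit.
have AE i : A i *m P1' = (AB i).1 *m P1 by rewrite /A /P1' mulmxA mulmxKV.
have piE i : i != oo -> pi i = rowspan (P0 + A i *m P1' + B i *m P2).
  by move=> ioo; rewrite AE ABE.
have free' (x y z : 'rV[F]_n) :
    x *m P0 + y *m P1' + z *m P2 = 0 -> [/\ x = 0, y = 0 & z = 0].
  rewrite mulmxA => /frame_free[-> ys ->]; split=> //.
  by rewrite -(mulmxK us y) ys mul0mx.
have [||||fK [r ur BK]] := @coord_field F m pi tau W oval_pi tan_tau compW regW
   oo i0 P0 P1' P2 A B free' pi_ooE _ piE i0oo _ _ i1 i1oo _ L t dimL prime_n t0 t1.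
- by move=> i; rewrite P1'E tau_nucleus.
- by rewrite /A AB0 mul0mx.
- by rewrite /B AB0.
- by rewrite /A mulmxV.
apply: (@regular_of_field F L m dimL prime_n pi oo P0 P1' (r *m P2) A
  (fun i => B i * r^-1) _ oval_pi fK).
- move=> v; have [x [y [z ->]]] := frame_span v.
  exists x, (y *m invmx s), (z *m invmx r).
  by rewrite /P1' !mulmxA !mulmxKV.
- by rewrite pi_ooE rowspan_unit.
- move=> i ioo; rewrite piE //; congr (rowspan (_ + _)).
  by rewrite mulmxA [B i * r^-1 *m r]mulrVK.
by move=> i ioo; split; [apply/imsetP; exists i | apply: BK].
Qed.

End RegularSpreadsRegularOval.

Local Close Scope ring_scope.

Theorem theorem6p2 (F : finFieldType) (L : splittingFieldType F) (h n : nat)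
    (pi tau W : 'I_(#|F| ^ n).+1 -> {vspace 'rV[F]_(3 * n)}) :
  #|F| = 2 ^ h -> 1 < h -> prime n -> \dim {:L} = n ->
  pseudo_oval pi ->
  (forall i, tangent_space pi i (tau i)) ->
  (forall i, \dim (W i) = 2 * n /\ disjoint_spaces (W i) (pi i)) ->
  regular_pseudo_oval L pi <->
  (forall i, regular_spread n (W i) (Delta pi tau i (W i))).
Proof.
case: n pi tau W => [|m] pi tau W cardF h_gt1 prime_n dimL oval_pi tan_tau compW.
  by [].
split=> [[g [ker0 [xi [x [dim_xi span_xi [_ x_xi _] piE]]]]] i | regW].
  have [act [e [actDl actDr actM actF pi_act]]] :=
    regular_module dimL ker0 dim_xi span_xi x_xi piE.
  have [dW cW] := compW i.
  exact: (regular_spread_of_module _ oval_pi tan_tau dimL actDl actDr actM actF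
    pi_act dW cW).
have even_q : ~~ odd #|F| by rewrite cardF oddX negb_or /= -lt0n (ltnW h_gt1).
(* This is where h > 1 is used, and not just h > 0. *)
have [t t0 t1] : exists2 t : F, t != 0%R & t != 1%R.
  have : (0 < #|~: [set 0%R; 1%R : F]|)%N.
    rewrite cardsCs setCK cards2 cardF subn_gt0.
    apply: (@leq_trans (2 ^ 2)); last by rewrite leq_exp2l.
    by case: (_ != _).
  by case/card_gt0P=> t; rewrite !inE negb_or => /andP[]; exists t.
pose oo : 'I_(#|F| ^ m.+1).+1 := ord0.
have [i0 i0oo _] := third_index (ltn0Sn m) oo oo.
have [_ dim_pi _] := oval_pi.
have [P0 pi0E P0_inj] := rowspan_basis (dim_pi i0).
have [P2 pi_ooE P2_inj] := rowspan_basis (dim_pi oo).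
have ooi0 : oo != i0 by rewrite eq_sym.
have [P1 nucE P1_inj] :=
  rowspan_basis (tau_cap (ltn0Sn m) oval_pi tan_tau ooi0).
exact: (regular_of_spreads oval_pi tan_tau even_q i0oo pi0E pi_ooE nucE
  P0_inj P1_inj P2_inj dimL prime_n t0 t1 compW regW).
Qed.
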